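(* The FIFO Stack-Up problem can be solved in time $O^*(2^m)$.
   Context: FIFO Stack-Up problem. An instance consists of a list $Q=(q_1,\ldots,q_k)$ of sequences of pairwise distinct bins, a pallet symbol ${\it plt}(b)$ (a positive integer) for every bin $b$, and a positive integer $p$. Standing assumption: every pallet symbol that occurs is carried by at least two bins. $m$ is the number of distinct pallet symbols (pallets). A configuration is a tuple $(i_1,\ldots,i_k)$ with $0\le i_j\le |q_j|$, meaning that the first $i_j$ bins of $q_j$ have been removed. A pallet $t$ is open in configuration $(i_1,\ldots,i_k)$ if there are indices $j,\ell$ such that some bin for $t$ is at a position $\le i_j$ in $q_j$ and some bin for $t$ is at a position $> i_\ell$ in $q_\ell$. A transformation step removes the bin at position $i_j+1$ of some sequence $q_j$ (with $i_j<|q_j|$). A processing of $Q$ is a sequence of transformation steps from $(0,\ldots,0)$ to $(|q_1|,\ldots,|q_k|)$. The question is whether there is a processing of $Q$ such that in each configuration during the processing at most $p$ pallets are open. The notation $O^*(\cdot)$ suppresses factors polynomial in the input size. *)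

(* Defs.v *)
From mathcomp Require Import all_boot.

Set Implicit Arguments.
Unset Strict Implicit.
Unset Printing Implicit Defensive.

(* Bins are named by natural numbers; only the values of [plt] on the bins
   that occur in [seqs] are part of the data (see [encode] below). *)
Record instance := Instance {
  seqs : seq (seq nat);
  plt : nat -> nat;
  places : nat }.

Section Instance.
Variable I : instance.

Definition bins : seq nat := flatten (seqs I).

Definition pallets : seq nat := undup (map (plt I) bins).

Definition num_pallets : nat := size pallets.

Definition valid : Prop :=
  [/\ uniq bins,
      forall b, b \in bins -> 0 < plt I b,
      0 < places I
    & forall t, t \in pallets -> 1 < count (fun b => plt I b == t) bins].

Definition config : Type := {ffun 'I_(size (seqs I)) -> nat}.

Definition sequence (j : 'I_(size (seqs I))) : seq nat := nth [::] (seqs I) j.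

Definition removed (c : config) j : seq nat := take (c j) (sequence j).
Definition remaining (c : config) j : seq nat := drop (c j) (sequence j).

Definition initial : config := [ffun => 0].
Definition final : config := [ffun j => size (sequence j)].

(* The two indices need not be distinct. *)
Definition is_open (c : config) (t : nat) : bool :=
  [exists j, exists l,
     (t \in map (plt I) (removed c j)) && (t \in map (plt I) (remaining c l))].

Definition num_open (c : config) : nat := count (is_open c) pallets.

Definition transformation (c c' : config) : bool :=
  [exists j, (c j < size (sequence j)) &&
     (c' == [ffun l => if l == j then (c l).+1 else c l])].

(* A processing is given by the configurations reached after [initial];
   the bounds c j <= size (sequence j) hold along it by construction. *)
Definition processing (s : seq config) : Prop :=
  path transformation initial s /\ last initial s = final.

Definition solvable : Prop :=
  exists s : seq config,
    processing s /\ forall c, c \in initial :: s -> num_open c <= places I.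

(* p, k, and then each sequence preceded by its length, every bin b being
   written as the two numbers b, plt b. *)
Definition encode : seq nat :=
  places I :: size (seqs I) ::
  flatten [seq size q :: flatten [seq [:: b; plt I b] | b <- q]
          | q <- seqs I].

End Instance.

(* The model of Cook and Reckhow: finitely many instructions, infinitely many
   registers holding natural numbers, indirect addressing, a one-way read-only
   input of natural numbers.  Up to factors logarithmic in the running time and
   polynomial in the input size, this is the model in which the running times of
   exponential algorithms are usually stated.  Time is charged by the number of
   bits of all constants, addresses and register contents involved, so no cost
   is hidden in arithmetic on large numbers. *)

Inductive instr :=
| Const (r a : nat)
| Plus (r a b : nat)
| Minus (r a b : nat)
| Fetch (r a : nat)
| Store (a r : nat)
| Read (r : nat)
| JumpZ (r l : nat).

Definition program := seq instr.

Record state := State { pc : nat; reg : nat -> nat; inp : seq nat }.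

Definition upd (R : nat -> nat) (r v : nat) : nat -> nat :=
  fun x => if x == r then v else R x.

Definition exec (i : instr) (s : state) : state :=
  let: State n R w := s in
  match i with
  | Const r a => State n.+1 (upd R r a) w
  | Plus r a b => State n.+1 (upd R r (R a + R b)) w
  | Minus r a b => State n.+1 (upd R r (R a - R b)) w
  | Fetch r a => State n.+1 (upd R r (R (R a))) w
  | Store a r => State n.+1 (upd R (R a) (R r)) w
  | Read r => State n.+1 (upd R r (head 0 w)) (behead w)
  | JumpZ r l => State (if R r == 0 then l else n.+1) R w
  end.

(* Length of the binary numeral of n; the numeral of 0 has length 1. *)
Definition bitlen (n : nat) : nat := (trunc_log 2 n).+1.

Definition bits (s : seq nat) : nat := sumn (map bitlen s).

Definition cost (i : instr) (s : state) : nat :=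
  let: State _ R w := s in
  match i with
  | Const r a => bits [:: r; a]
  | Plus r a b | Minus r a b => bits [:: r; a; b; R a; R b]
  | Fetch r a => bits [:: r; a; R a; R (R a)]
  | Store a r => bits [:: a; R a; r; R r]
  | Read r => bits [:: r; head 0 w]
  | JumpZ r _ => bits [:: r; R r]
  end.

(* A program halts when its counter leaves the list of instructions. *)
Inductive runs (P : program) : state -> nat -> state -> Prop :=
| runs_halt s : size P <= pc s -> runs P s 0 s
| runs_step s t s' :
    pc s < size P ->
    let i := nth (Const 0 0) P (pc s) in
    runs P (exec i s) t s' -> runs P s (cost i s + t) s'.

Definition start (w : seq nat) : state := State 0 (fun=> 0) w.

Definition accepting (s : state) : Prop := reg s 0 != 0.

(* Main.v *)
Require Import Defs.
From mathcomp Require Import all_boot.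
From mathcomp Require Import zify.

Set Implicit Arguments.
Unset Strict Implicit.
Unset Printing Implicit Defensive.

(* For a set S of pallets, remove from every sequence its longest prefix made
   of bins for S, and call t in S stuck if a bin for t is left.  Once the pallets
   of S have been opened it never hurts to remove all these prefixes, and the
   bin that then opens the next pallet leaves it open, because every pallet has
   at least two bins.  So the instance is solvable iff the pallets can be
   ordered such that every proper initial segment S has fewer than p stuck
   pallets.  The orders are searched by dynamic programming over the 2^m sets S,
   coded as the numbers x < 2^m: mark 0, and from a marked x with fewer than p
   stuck pallets mark x + 2^t for every t that is not in the set coded by x.

   Pallet symbols are renamed 1, .., m in the order of their first occurrences,
   using the symbol itself as an address; the cost of such an address is bounded
   by the length of the input. *)

(** * A structured language compiled to the machine *)

(** The number of configurations is not bounded in terms of m, so the criterion has to depend on the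
    set S alone. While the removed prefixes grow from those for S to those for S with t added, every
    open pallet is t or stuck for S, whatever the order of the removals. Conversely, when a
    processing removes its first bin for t and S is the set of pallets met before, no sequence has
    been emptied beyond its prefix for S, so the stuck pallets of S are all open together with t.
    Having fewer than p stuck pallets thus means having at most p open ones, t included. The bound
    is on bit costs of a concrete machine, so the search is written in a structured language and
    verified with a count of instructions. All its values stay at most X = 2^B, with B the bit
    length of the input, and 2^(m+1) <= X because every pallet occupies numbers of the encoding.
    Hence one instruction costs O(B), and this uniform charge is multiplied by the count. *)

Inductive com :=
| Skip
| Assign (r a : nat)
| Sum (r a b : nat)
| Diff (r a b : nat)
| Get (r A x : nat)
| Put (A x r : nat)
| Inp (r : nat)
| Seq (c1 c2 : com)
| Cond (r : nat) (c1 c2 : com)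
| While (r : nat) (c : com).

Fixpoint wf (c : com) : bool :=
  match c with
  | Skip => true
  | Assign r a => (r < 30) && (a < 2)
  | Sum r a b | Diff r a b => [&& r < 30, a < 30 & b < 30]
  | Get r A x | Put A x r => [&& r < 30, A < 8 & x < 30]
  | Inp r => r < 30
  | Seq c1 c2 => wf c1 && wf c2
  | Cond r c1 c2 => [&& r < 30, wf c1 & wf c2]
  | While r c => (r < 30) && wf c
  end.

(** Registers below 30 hold scalars, 30 and 31 are scratch, and eight arrays are interleaved from 32
    on, so that each is unbounded and they are pairwise disjoint. *)
Definition addr (A x : nat) : nat := 32 + A + 8 * x.

(* Leaves [addr A x] in register 31. *)
Definition address (A x : nat) : program :=
  [:: Plus 31 x x; Plus 31 31 31; Plus 31 31 31; Const 30 (32 + A);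
      Plus 31 31 30].

Fixpoint clen (c : com) : nat :=
  match c with
  | Skip => 0
  | Assign _ _ | Sum _ _ _ | Diff _ _ _ | Inp _ => 1
  | Get _ _ _ | Put _ _ _ => 6
  | Seq c1 c2 => clen c1 + clen c2
  | Cond _ c1 c2 => clen c1 + clen c2 + 3
  | While _ c => clen c + 3
  end.

(* Unconditional jumps go through register 30, cleared just before. *)
Fixpoint compile (o : nat) (c : com) : program :=
  match c with
  | Skip => [::]
  | Assign r a => [:: Const r a]
  | Sum r a b => [:: Plus r a b]
  | Diff r a b => [:: Minus r a b]
  | Get r A x => rcons (address A x) (Fetch r 31)
  | Put A x r => rcons (address A x) (Store 31 r)
  | Inp r => [:: Read r]
  | Seq c1 c2 => compile o c1 ++ compile (o + clen c1) c2
  | Cond r c1 c2 =>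
      JumpZ r (o + (clen c1 + 3)) :: compile o.+1 c1 ++
      [:: Const 30 0; JumpZ 30 (o + (clen c1 + clen c2 + 3))] ++
      compile (o + (clen c1 + 3)) c2
  | While r c =>
      JumpZ r (o + (clen c + 3)) :: compile o.+1 c ++
      [:: Const 30 0; JumpZ 30 o]
  end.

Lemma size_compile o c : size (compile o c) = clen c.
Proof.
elim: c o => //= [c1 IH1 c2 IH2|r c1 IH1 c2 IH2|r c IH] o.
- by rewrite size_cat IH1 IH2.
- by rewrite size_cat /= IH1 IH2; lia.
- by rewrite size_cat /= IH; lia.
Qed.

(** [tm] counts machine instructions; bit costs enter only in the simulation, as one bound [W] for
    every instruction. *)
Record memory := Memory {
  sc : nat -> nat;
  ar : nat -> nat -> nat;
  ip : seq nat;
  tm : nat }.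

Definition setr (m : memory) r v n :=
  Memory (upd (sc m) r v) (ar m) (ip m) (tm m + n).
Definition seta (m : memory) A x v n :=
  Memory (sc m) (fun B => if B == A then upd (ar m A) x v else ar m B)
      (ip m) (tm m + n).
Definition tick (m : memory) n := Memory (sc m) (ar m) (ip m) (tm m + n).

(* [X] bounds every value; only additions can exceed it. *)
Inductive ev (X : nat) : com -> memory -> memory -> Prop :=
| ev_skip m : ev X Skip m m
| ev_assign r a m : ev X (Assign r a) m (setr m r a 1)
| ev_add r a b m : sc m a + sc m b <= X ->
    ev X (Sum r a b) m (setr m r (sc m a + sc m b) 1)
| ev_sub r a b m : ev X (Diff r a b) m (setr m r (sc m a - sc m b) 1)
| ev_get r A x m : ev X (Get r A x) m (setr m r (ar m A (sc m x)) 6)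
| ev_put A x r m : ev X (Put A x r) m (seta m A (sc m x) (sc m r) 6)
| ev_inp r m : ev X (Inp r) m
    (Memory (upd (sc m) r (head 0 (ip m))) (ar m) (behead (ip m)) (tm m + 1))
| ev_seq c1 c2 m m1 m2 : ev X c1 m m1 -> ev X c2 m1 m2 -> ev X (Seq c1 c2) m m2
| ev_cond1 r c1 c2 m m1 : sc m r != 0 -> ev X c1 (tick m 1) m1 ->
    ev X (Cond r c1 c2) m (tick m1 2)
| ev_cond0 r c1 c2 m m1 : sc m r = 0 -> ev X c2 (tick m 1) m1 ->
    ev X (Cond r c1 c2) m m1
| ev_while0 r c m : sc m r = 0 -> ev X (While r c) m (tick m 1)
| ev_while1 r c m m1 m2 : sc m r != 0 -> ev X c (tick m 1) m1 ->
    ev X (While r c) (tick m1 2) m2 -> ev X (While r c) m m2.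

(** * Simulation of the structured language by the machine *)

Section Simulation.
Variables (X V W : nat).
Hypothesis X_gt0 : 0 < X.
Hypothesis V_big : 8 * X + 40 <= V.
Hypothesis W_big : 5 * bitlen V <= W.

(** Scratch registers may exceed [X], since they hold addresses up to [8 * X + 39]; hence the
    separate bound [V]. *)
Definition sim (m : memory) (R : nat -> nat) (w : seq nat) : Prop :=
  [/\ forall r, r < 30 -> R r = sc m r /\ R r <= X,
      forall A x, A < 8 -> R (addr A x) = ar m A x /\ R (addr A x) <= X,
      forall r, R r <= V,
      w = ip m
    & forall a, a \in w -> a <= X].

Lemma leq_bitlen a b : a <= b -> bitlen a <= bitlen b.
Proof. by move=> h; rewrite ltnS leq_trunc_log. Qed.

Lemma bits_small s : size s <= 5 -> all (fun a => a <= V) s -> bits s <= W.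
Proof.
move=> s5 sV; apply: leq_trans W_big.
apply: (@leq_trans (size s * bitlen V)); last by rewrite leq_mul2r s5 orbT.
elim: s sV {s5} => //= a s IH /andP[aV sV]; rewrite /bits /= mulSn.
by apply: leq_add; [apply: leq_bitlen | apply: IH].
Qed.

Definition regs_in (i : instr) : seq nat :=
  match i with
  | Const r a => [:: r; a]
  | Plus r a b | Minus r a b => [:: r; a; b]
  | Fetch r a | Store a r => [:: r; a]
  | Read r | JumpZ r _ => [:: r]
  end.

(** An instruction is charged for at most five numbers; jump targets are free, so [regs_in] omits
    them. *)
Lemma cost_small i n R w : all (fun a => a <= V) (regs_in i) ->
  (forall r, R r <= V) -> head 0 w <= V -> cost i (State n R w) <= W.
Proof.
move=> iV RV wV; case: i iV => [r a|r a b|r a b|r a|a r|r|r l] /= iV;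
apply: bits_small => //=; rewrite ?RV ?wV ?andbT //.
all: first [ by case/and3P: iV => -> -> /andP[->]
           | by case/andP: iV => -> /andP[->] | by case/andP: iV => ->].
Qed.

Lemma runs_instr P pre i post s t s' :
  P = pre ++ i :: post -> pc s = size pre -> cost i s <= W ->
  runs P (exec i s) t s' ->
  exists2 t', t' <= W + t & runs P s t' s'.
Proof.
move=> -> es ci rs.
exists (cost i s + t); first by rewrite leq_add2r.
have := @runs_step (pre ++ i :: post) s t s'.
rewrite es nth_cat ltnn subnn /=; apply => //.
by rewrite size_cat /= addnS ltnS leq_addr.
Qed.
(** Continuation form: a halting run from [s1] is prolonged backwards to one from [s], which
    composes without a separate relation for unfinished runs. *)
Definition leads P s n s1 :=
  forall t s', runs P s1 t s' -> exists2 t', t' <= n * W + t & runs P s t' s'.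

Lemma leads0 P s : leads P s 0 s.
Proof. by move=> t s' r; exists t. Qed.

Lemma leads_trans P s n s1 n' s2 :
  leads P s n s1 -> leads P s1 n' s2 -> leads P s (n + n') s2.
Proof.
move=> h1 h2 t s' /h2[t1 t1b /h1[t2 t2b r]].
by exists t2 => //; rewrite mulnDl -addnA; apply: leq_trans t2b _; rewrite leq_add2l.
Qed.

Lemma leads1 P pre i post R w :
  P = pre ++ i :: post ->
  all (fun a => a <= V) (regs_in i) -> (forall r, R r <= V) -> head 0 w <= V ->
  leads P (State (size pre) R w) 1 (exec i (State (size pre) R w)).
Proof.
move=> eP iV RV wV t s' r; rewrite mul1n.
by apply: runs_instr eP _ _ r => //; apply: cost_small.
Qed.

Lemma sim_setr m R w r v n : r < 30 -> v <= X -> sim m R w ->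
  sim (setr m r v n) (upd R r v) w.
Proof.
move=> r30 vX [hs ha hV hw hi]; split=> //= [q q30|A x A8|q].
- by rewrite /upd; case: eqP => // _; apply: hs.
- by rewrite /upd ifN; [apply: ha | rewrite /addr; lia].
- by rewrite /upd; case: eqP => // _; lia.
Qed.

Lemma sim_scratch m R w r v : 30 <= r < 32 -> v <= V -> sim m R w ->
  sim m (upd R r v) w.
Proof.
move=> r30 vX [hs ha hV hw hi]; split=> //= [q q30|A x A8|q].
- by rewrite /upd ifN; [apply: hs | lia].
- by rewrite /upd ifN; [apply: ha | rewrite /addr; lia].
- by rewrite /upd; case: eqP.
Qed.

Lemma sim_seta m R w A x v n : A < 8 -> v <= X -> sim m R w ->
  sim (seta m A x v n) (upd R (addr A x) v) w.
Proof.
move=> A8 vX [hs ha hV hw hi]; split=> //= [q q30|B y B8|q].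
- by rewrite /upd ifN; [apply: hs | rewrite /addr; lia].
- rewrite /upd; have -> : (addr B y == addr A x) = (B == A) && (y == x).
    by apply/eqP/andP => [|[/eqP-> /eqP->]//]; rewrite /addr => h;
       split; apply/eqP; lia.
  case: (B =P A) => [->|_] /=; last exact: ha.
  by case: (y =P x) => // _; apply: ha.
- by rewrite /upd; case: eqP => // _; lia.
Qed.

Lemma head_small m R w : sim m R w -> head 0 w <= X.
Proof. by case=> _ _ _ _; case: w => //= a w; apply; apply: mem_head. Qed.

Lemma leads_sim P pre i post m R w :
  P = pre ++ i :: post -> all (fun a => a <= V) (regs_in i) -> sim m R w ->
  leads P (State (size pre) R w) 1 (exec i (State (size pre) R w)).
Proof.
move=> eP iV s; apply: leads1 eP iV _ _; first by case: s.
by apply: leq_trans (head_small s) _; lia.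
Qed.

Lemma leads_address P pre A x post m R w :
  P = pre ++ address A x ++ post -> A < 8 -> x < 30 -> sim m R w ->
  exists R', [/\ sim m R' w, R' 31 = addr A (sc m x)
    & leads P (State (size pre) R w) 5 (State (size pre + 5) R' w)].
Proof.
move=> eP A8 x30 s; have [hs _ _ _ _] := s.
have [ex xX] := hs x x30.
set R1 := upd R 31 (R x + R x).
set R2 := upd R1 31 (R1 31 + R1 31).
set R3 := upd R2 31 (R2 31 + R2 31).
set R4 := upd R3 30 (32 + A).
set R5 := upd R4 31 (R4 31 + R4 30).
have e1 : R1 31 = 2 * R x by rewrite /R1 /upd /=; lia.
have e2 : R2 31 = 4 * R x by rewrite /R2 /upd /= e1; lia.
have e3 : R3 31 = 8 * R x by rewrite /R3 /upd /= e2; lia.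
have e4 : R4 31 = 8 * R x by rewrite /R4 /upd /= e3.
have e4' : R4 30 = 32 + A by [].
have e5 : R5 31 = addr A (R x) by rewrite /R5 /upd /= e4 /addr; lia.
have s1 : sim m R1 w by apply: sim_scratch => //; lia.
have s2 : sim m R2 w by apply: sim_scratch => //; lia.
have s3 : sim m R3 w by apply: sim_scratch => //; lia.
have s4 : sim m R4 w by apply: sim_scratch => //; lia.
have s5 : sim m R5 w by apply: sim_scratch => //; lia.
exists R5; split=> //; first by rewrite e5 ex.
have st k i post' Ra Rb : P = (pre ++ take k (address A x)) ++ i :: post' ->
    k < 5 -> all (fun a => a <= V) (regs_in i) -> sim m Ra w ->
    exec i (State (size pre + k) Ra w) = State (size pre + k.+1) Rb w ->
    leads P (State (size pre + k) Ra w) 1 (State (size pre + k.+1) Rb w).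
  move=> e k5 iV sa <-.
  have -> : size pre + k = size (pre ++ take k (address A x)).
    by rewrite size_cat size_take /= k5.
  exact: leads_sim e iV sa.
have V32 : 32 + A <= V by lia.
have [V31 V30] : 31 <= V /\ 30 <= V by lia.
have xV : x <= V by lia.
have l1 : leads P (State (size pre + 0) R w) 1 (State (size pre + 1) R1 w).
  apply: (st 0 (Plus 31 x x) _ R R1 _ _ _ s); rewrite ?addnS //=; last by lia.
  by rewrite eP -catA.
have l2 : leads P (State (size pre + 1) R1 w) 1 (State (size pre + 2) R2 w).
  apply: (st 1 (Plus 31 31 31) _ R1 R2 _ _ _ s1); rewrite ?addnS //=; last by lia.
  by rewrite eP -catA.
have l3 : leads P (State (size pre + 2) R2 w) 1 (State (size pre + 3) R3 w).
  apply: (st 2 (Plus 31 31 31) _ R2 R3 _ _ _ s2); rewrite ?addnS //=; last by lia.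
  by rewrite eP -catA.
have l4 : leads P (State (size pre + 3) R3 w) 1 (State (size pre + 4) R4 w).
  apply: (st 3 (Const 30 (32 + A)) _ R3 R4 _ _ _ s3); rewrite ?addnS //=; last by lia.
  by rewrite eP -catA.
have l5 : leads P (State (size pre + 4) R4 w) 1 (State (size pre + 5) R5 w).
  apply: (st 4 (Plus 31 31 30) _ R4 R5 _ _ _ s4); rewrite ?addnS //=; last by lia.
  by rewrite eP -catA.
rewrite addn0 in l1.
exact: leads_trans (leads_trans (leads_trans (leads_trans l1 l2) l3) l4) l5.
Qed.

(** Induction on the evaluation. Jump targets are absolute, so the code has to sit at the offset
    [size pre] for which it was compiled; [pre] and [post] are quantified inside because subcommands
    shift the offset. *)
Theorem simulation c m m' : ev X c m m' -> wf c ->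
  forall P pre post R w,
  P = pre ++ compile (size pre) c ++ post -> sim m R w ->
  exists R' w' n, [/\ sim m' R' w',
    leads P (State (size pre) R w) n (State (size pre + clen c) R' w')
    & tm m' = tm m + n].
Proof.
have V40 : 40 <= V by lia.
have small r : r < 30 -> r <= V by lia.
elim=> {c m m'} /=.
- move=> m _ P pre post R w eP s; exists R, w, 0; rewrite !addn0.
  by split=> //; apply: leads0.
- move=> r a m /andP[r30 a2] P pre post R w eP s.
  exists (upd R r a), w, 1; split=> //; first by apply: sim_setr => //; lia.
  rewrite addn1; apply: leads_sim eP _ s.
  by rewrite /= small //=; lia.
- move=> r a b m le /and3P[r30 a30 b30] P pre post R w eP s.
  have [hs _ _ _ _] := s; have [ea _] := hs _ a30; have [eb _] := hs _ b30.
  exists (upd R r (sc m a + sc m b)), w, 1; split=> //; first exact: sim_setr.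
  rewrite addn1 -ea -eb; apply: leads_sim eP _ s.
  by rewrite /= !small.
- move=> r a b m /and3P[r30 a30 b30] P pre post R w eP s.
  have [hs _ _ _ _] := s; have [ea aX] := hs _ a30; have [eb _] := hs _ b30.
  exists (upd R r (sc m a - sc m b)), w, 1; split=> //.
    by apply: sim_setr => //; lia.
  rewrite addn1 -ea -eb; apply: leads_sim eP _ s.
  by rewrite /= !small.
- move=> r A x m /and3P[r30 A8 x30] P pre post R w eP s.
  have {}eP : P = pre ++ address A x ++ Fetch r 31 :: post by [].
  have [R' [s' e31 l]] := leads_address eP A8 x30 s.
  have [_ ha _ _ _] := s'; have [ea aX] := ha A (sc m x) A8.
  exists (upd R' r (ar m A (sc m x))), w, 6; split=> //.
    by apply: sim_setr => //; rewrite -ea.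
  rewrite -[6]/(5 + 1); apply: leads_trans l _.
  have := @leads_sim P (pre ++ address A x) (Fetch r 31) post m R' w.
  rewrite size_cat /= e31 ea addnA addn1; apply=> //; first by rewrite eP -!catA.
  by rewrite small //=; lia.
- move=> A x r m /and3P[r30 A8 x30] P pre post R w eP s.
  have {}eP : P = pre ++ address A x ++ Store 31 r :: post by [].
  have [R' [s' e31 l]] := leads_address eP A8 x30 s.
  have [hs _ _ _ _] := s'; have [er rX] := hs _ r30.
  exists (upd R' (addr A (sc m x)) (sc m r)), w, 6; split=> //.
    by apply: sim_seta => //; rewrite -er.
  rewrite -[6]/(5 + 1); apply: leads_trans l _.
  have := @leads_sim P (pre ++ address A x) (Store 31 r) post m R' w.
  rewrite size_cat /= e31 er addnA addn1; apply=> //; first by rewrite eP -!catA.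
  by rewrite (small r) //=; lia.
- move=> r m r30 P pre post R w eP s.
  have [_ _ _ ew hi] := s.
  exists (upd R r (head 0 w)), (behead w), 1; split=> //.
    have [hs ha hV _ _] := sim_setr 1 r30 (head_small s) s.
    split=> //=; last by move=> a /mem_behead; apply: hi.
      by move=> q /hs /=; rewrite ew.
    by rewrite ew.
  rewrite addn1; apply: leads_sim eP _ s.
  by rewrite /= !small.
- move=> c1 c2 m m1 m2 _ IH1 _ IH2 /andP[w1 w2] P pre post R w eP s.
  rewrite -catA in eP.
  have [R1 [u1 [n1 [s1 l1 t1]]]] := IH1 w1 P pre _ R w eP s.
  have := IH2 w2 P (pre ++ compile (size pre) c1) post R1 u1.
  rewrite size_cat size_compile -catA => /(_ eP s1) [R2 [u2 [n2 [s2 l2 t2]]]].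
  exists R2, u2, (n1 + n2); rewrite addnA t2 t1 addnA; split=> //.
  exact: leads_trans l1 l2.
- move=> r c1 c2 m m1 nz _ IH /and3P[r30 w1 w2] P pre post R w eP s.
  have [hs _ _ _ _] := s; have [er _] := hs _ r30.
  have l0 := leads_sim eP _ s; rewrite /= er (negbTE nz) small // in l0.
  have := IH w1 P (pre ++ [:: JumpZ r (size pre + (clen c1 + 3))])
    ([:: Const 30 0; JumpZ 30 (size pre + (clen c1 + clen c2 + 3))] ++
     compile (size pre + (clen c1 + 3)) c2 ++ post) R w.
  rewrite size_cat /= addn1 => -[|//|R1 [u1 [n1 [s1 l1 t1]]]].
    by rewrite eP -!catA /= -?catA ?addn1.
  have s2 : sim m1 (upd R1 30 0) u1 by apply: sim_scratch.
  exists (upd R1 30 0), u1, (1 + n1 + 2); split=> //; last by rewrite t1 /=; lia.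
  apply: leads_trans; first by apply: leads_trans l1; apply: l0.
  set pre2 := pre ++ JumpZ r (size pre + (clen c1 + 3)) :: compile (size pre).+1 c1.
  have sp : size pre2 = (size pre).+1 + clen c1.
    by rewrite size_cat /= size_compile; lia.
  rewrite -sp -[2]/(1 + 1).
  have := @leads_sim P pre2 (Const 30 0) _ m1 R1 u1.
  move=> /(_ (JumpZ 30 (size pre + (clen c1 + clen c2 + 3)) ::
             compile (size pre + (clen c1 + 3)) c2 ++ post)) l2.
  apply: leads_trans; first apply: l2 => //=.
    by rewrite eP /pre2 -!catA /= -?catA.
    by lia.
  have := @leads_sim P (rcons pre2 (Const 30 0))
    (JumpZ 30 (size pre + (clen c1 + clen c2 + 3))) _ m1 (upd R1 30 0) u1.
  move=> /(_ (compile (size pre + (clen c1 + 3)) c2 ++ post)).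
  rewrite size_rcons /=; apply=> //; last by lia.
  by rewrite eP /pre2 -cats1 -!catA /= -?catA.
- move=> r c1 c2 m m1 z _ IH /and3P[r30 w1 w2] P pre post R w eP s.
  have [hs _ _ _ _] := s; have [er _] := hs _ r30.
  have l0 := leads_sim eP _ s; rewrite /= er z eqxx small // in l0.
  set pre2 := pre ++ JumpZ r (size pre + (clen c1 + 3)) :: compile (size pre).+1 c1
    ++ [:: Const 30 0; JumpZ 30 (size pre + (clen c1 + clen c2 + 3))].
  have sp : size pre2 = size pre + (clen c1 + 3).
    by rewrite size_cat /= size_cat size_compile /=; lia.
  have := IH w2 P pre2 post R w.
  rewrite sp => -[|//|R1 [u1 [n1 [s1 l1 t1]]]].
    by rewrite eP /pre2 -!catA /= -?catA ?addn1.
  exists R1, u1, (1 + n1); split=> //; last by rewrite t1 /=; lia.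
  apply: leads_trans; first exact: l0.
  suff -> : size pre + (clen c1 + clen c2 + 3) = size pre + (clen c1 + 3) + clen c2.
    by [].
  by lia.
- move=> r c m z /andP[r30 w1] P pre post R w eP s.
  have [hs _ _ _ _] := s; have [er _] := hs _ r30.
  have l0 := leads_sim eP _ s; rewrite /= er z eqxx small // in l0.
  by exists R, w, 1; split=> //; apply: l0.
- move=> r c m m1 m2 nz _ IH1 _ IH2 /andP[r30 w1] P pre post R w eP s.
  have [hs _ _ _ _] := s; have [er _] := hs _ r30.
  have l0 := leads_sim eP _ s; rewrite /= er (negbTE nz) small // in l0.
  have := IH1 w1 P (pre ++ [:: JumpZ r (size pre + (clen c + 3))])
    ([:: Const 30 0; JumpZ 30 (size pre)] ++ post) R w.
  rewrite size_cat /= addn1 => -[|//|R1 [u1 [n1 [s1 l1 t1]]]].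
    by rewrite eP -!catA /= -?catA ?addn1.
  have s2 : sim (tick m1 2) (upd R1 30 0) u1.
    have : sim m1 (upd R1 30 0) u1 by apply: sim_scratch.
    by [].
  have [|R2 [u2 [n2 [s3 l3 t3]]]] := IH2 _ P pre post _ _ eP s2.
    by rewrite r30.
  exists R2, u2, (1 + n1 + 2 + n2); split=> //; last by rewrite t3 /= t1 /=; lia.
  apply: leads_trans l3.
  apply: leads_trans; first by apply: leads_trans l1; apply: l0.
  set pre2 := pre ++ JumpZ r (size pre + (clen c + 3)) :: compile (size pre).+1 c.
  have sp : size pre2 = (size pre).+1 + clen c.
    by rewrite size_cat /= size_compile; lia.
  rewrite -sp -[2]/(1 + 1).
  have := @leads_sim P pre2 (Const 30 0) _ m1 R1 u1.
  move=> /(_ (JumpZ 30 (size pre) :: post)) l2.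
  apply: leads_trans; first apply: l2 => //=.
    by rewrite eP /pre2 -!catA /= -?catA.
    by lia.
  have := @leads_sim P (rcons pre2 (Const 30 0))
    (JumpZ 30 (size pre)) _ m1 (upd R1 30 0) u1.
  move=> /(_ post).
  rewrite size_rcons /=; apply=> //; last by lia.
  by rewrite eP /pre2 -cats1 -!catA /= -?catA.
Qed.

End Simulation.

Lemma compile_runs X W c w m :
  0 < X -> 5 * bitlen (8 * X + 40) <= W -> (forall a, a \in w -> a <= X) ->
  wf c -> ev X c (Memory (fun=> 0) (fun _ _ => 0) w 0) m ->
  exists t s, [/\ runs (compile 0 c) (start w) t s, t <= tm m * W
    & reg s 0 = sc m 0].
Proof.
move=> X0 W5 wX cwf e.
have s0 : sim X (8 * X + 40) (Memory (fun=> 0) (fun _ _ => 0) w 0) (fun=> 0) w by [].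
have [|R [u [n [s l t]]]] := @simulation X _ W X0 (leqnn _) W5 _ _ _ e cwf
  (compile 0 c) [::] [::] _ _ _ s0; first by rewrite /= cats0.
have /l[t' le r] : runs (compile 0 c) (State (0 + clen c) R u) 0 (State (0 + clen c) R u).
  by apply: runs_halt; rewrite size_compile.
exists t', (State (0 + clen c) R u); split=> //=.
  by rewrite t add0n -[n * W]addn0.
by case: s => /(_ 0 isT) [].
Qed.

(** * Frame conditions *)

Fixpoint wr (c : com) : seq nat :=
  match c with
  | Skip | Put _ _ _ => [::]
  | Assign r _ | Sum r _ _ | Diff r _ _ | Get r _ _ | Inp r => [:: r]
  | Seq c1 c2 | Cond _ c1 c2 => wr c1 ++ wr c2
  | While _ c => wr c
  end.

Fixpoint wa (c : com) : seq nat :=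
  match c with
  | Put A _ _ => [:: A]
  | Seq c1 c2 | Cond _ c1 c2 => wa c1 ++ wa c2
  | While _ c => wa c
  | _ => [::]
  end.

Fixpoint reads (c : com) : bool :=
  match c with
  | Inp _ => true
  | Seq c1 c2 | Cond _ c1 c2 => reads c1 || reads c2
  | While _ c => reads c
  | _ => false
  end.

(** [wr], [wa] and [reads] bound syntactically what a command can alter, so that side conditions on
    unchanged data are settled by computation and specifications mention only what changes. *)
Definition frame c m m' : Prop :=
  [/\ forall r, r \notin wr c -> sc m' r = sc m r,
      forall A, A \notin wa c -> ar m' A = ar m A
    & ~~ reads c -> ip m' = ip m].

Lemma frame_trans c m1 m2 m3 : frame c m1 m2 -> frame c m2 m3 -> frame c m1 m3.
Proof.
case=> f1 f2 f3 [g1 g2 g3]; split=> [r h|A h|h].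
- by rewrite g1 // f1.
- by rewrite g2 // f2.
- by rewrite g3 // f3.
Qed.

Definition sub_writes c c' :=
  [/\ {subset wr c <= wr c'}, {subset wa c <= wa c'} & reads c -> reads c'].

Lemma frame_sub c c' m m' : sub_writes c c' -> frame c m m' -> frame c' m m'.
Proof.
case=> s1 s2 s3 [f1 f2 f3]; split=> [r|A|]; move=> h.
- by apply: f1; apply: contra h; apply: s1.
- by apply: f2; apply: contra h; apply: s2.
- by apply: f3; apply: contra h; apply: s3.
Qed.

Lemma ev_frame X c m m' : ev X c m m' -> frame c m m'.
Proof.
elim=> {c m m'}.
- by [].
- by move=> r a m; split=> //= q; rewrite inE /upd => /negbTE ->.
- by move=> r a b m _; split=> //= q; rewrite inE /upd => /negbTE ->.
- by move=> r a b m; split=> //= q; rewrite inE /upd => /negbTE ->.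
- by move=> r A x m; split=> //= q; rewrite inE /upd => /negbTE ->.
- by move=> A x r m; split=> //= q; rewrite inE /upd => /negbTE ->.
- by move=> r m; split=> //= q; rewrite inE /upd => /negbTE ->.
- move=> c1 c2 m m1 m2 _ f1 _ f2; apply: (@frame_trans _ _ m1).
    by apply: frame_sub f1; split=> [r|A|] /=; rewrite ?mem_cat => ->.
  by apply: frame_sub f2; split=> [r|A|] /=; rewrite ?mem_cat => ->; rewrite orbT.
- move=> r c1 c2 m m1 _ _ f.
  have {}f : frame c1 m (tick m1 2) by [].
  by apply: frame_sub f; split=> [q|A|] /=; rewrite ?mem_cat => ->.
- move=> r c1 c2 m m1 _ _ f.
  have {}f : frame c2 m m1 by [].
  by apply: frame_sub f; split=> [q|A|] /=; rewrite ?mem_cat => ->; rewrite orbT.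
- by [].
- move=> r c m m1 m2 _ _ f1 _ f2.
  have g1 : frame (While r c) m m1 by apply: (@frame_sub c) f1; split.
  exact: frame_trans g1 f2.
Qed.

(** * Weakest preconditions and counting loops *)

Section Wp.
Variable X : nat.

(** Total correctness: an evaluation is a finite derivation, so termination and the bound [X] on all
    sums are included. *)
Definition wp c (Q : memory -> Prop) m : Prop := exists2 m', ev X c m m' & Q m'.

Lemma wp_conseq c (Q Q' : memory -> Prop) m :
  wp c Q m -> (forall m', frame c m m' -> Q m' -> Q' m') -> wp c Q' m.
Proof. by case=> m' e q h; exists m' => //; apply: h q; apply: ev_frame e. Qed.

Lemma wp_skip (Q : memory -> Prop) m : Q m -> wp Skip Q m.
Proof. by exists m => //; constructor. Qed.

Lemma wp_assign (Q : memory -> Prop) r a m : Q (setr m r a 1) -> wp (Assign r a) Q m.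
Proof. by eexists; last eassumption; constructor. Qed.

Lemma wp_add (Q : memory -> Prop) r a b m : sc m a + sc m b <= X ->
  Q (setr m r (sc m a + sc m b) 1) -> wp (Sum r a b) Q m.
Proof. by eexists; last eassumption; constructor. Qed.

Lemma wp_sub (Q : memory -> Prop) r a b m :
  Q (setr m r (sc m a - sc m b) 1) -> wp (Diff r a b) Q m.
Proof. by eexists; last eassumption; constructor. Qed.

Lemma wp_get (Q : memory -> Prop) r A x m :
  Q (setr m r (ar m A (sc m x)) 6) -> wp (Get r A x) Q m.
Proof. by eexists; last eassumption; constructor. Qed.

Lemma wp_put (Q : memory -> Prop) r A x m :
  Q (seta m A (sc m x) (sc m r) 6) -> wp (Put A x r) Q m.
Proof. by eexists; last eassumption; constructor. Qed.

Lemma wp_inp (Q : memory -> Prop) r m :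
  Q (Memory (upd (sc m) r (head 0 (ip m))) (ar m) (behead (ip m)) (tm m + 1)) ->
  wp (Inp r) Q m.
Proof. by eexists; last eassumption; constructor. Qed.

Lemma wp_seq (Q : memory -> Prop) c1 c2 m :
  wp c1 (wp c2 Q) m -> wp (Seq c1 c2) Q m.
Proof. by case=> m1 e1 [m2 e2 q]; exists m2 => //; apply: ev_seq e1 e2. Qed.

Lemma wp_cond (Q : memory -> Prop) r c1 c2 m :
  (sc m r != 0 -> wp c1 (fun m' => Q (tick m' 2)) (tick m 1)) ->
  (sc m r = 0 -> wp c2 Q (tick m 1)) -> wp (Cond r c1 c2) Q m.
Proof.
move=> h1 h0; case: (altP (sc m r =P 0)) h1 h0 => [z _|nz].
  by case/(_ z)=> m' e q; exists m' => //; apply: ev_cond0.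
by case/(_ isT)=> m' e q _; exists (tick m' 2) => //; apply: ev_cond1.
Qed.

(* Register 1 has to hold 1. *)
Definition For r c := While r (Seq c (Diff r r 1)).

(* [b] bounds the time of one execution of the body. *)
Lemma wp_for r c b k Q m
    (Inv : nat -> (nat -> nat) -> (nat -> nat -> nat) -> seq nat -> Prop) :
  (1 \notin r :: wr c) && (r \notin wr c) ->
  sc m r = k -> sc m 1 = 1 -> Inv k (sc m) (ar m) (ip m) ->
  (forall j m1, j < k -> frame (For r c) m m1 -> sc m1 r = j.+1 ->
     Inv j.+1 (sc m1) (ar m1) (ip m1) ->
     wp c (fun m2 => tm m2 <= tm m1 + b /\
                     Inv j (upd (sc m2) r j) (ar m2) (ip m2)) m1) ->
  (forall m1, frame (For r c) m m1 -> sc m1 r = 0 ->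
     Inv 0 (sc m1) (ar m1) (ip m1) -> tm m1 <= tm m + k * (b + 4) + 1 -> Q m1) ->
  wp (For r c) Q m.
Proof.
case/andP; rewrite inE negb_or => /andP[r1 w1] rw ek e1 iv body.
set K := k; rewrite -{1}/K in body *.
suff main j m1 : j <= k -> frame (For r c) m m1 -> sc m1 r = j ->
    Inv j (sc m1) (ar m1) (ip m1) ->
    (forall m2, frame (For r c) m m2 -> sc m2 r = 0 ->
     Inv 0 (sc m2) (ar m2) (ip m2) -> tm m2 <= tm m1 + j * (b + 4) + 1 -> Q m2) ->
    wp (For r c) Q m1.
  by apply: main ek iv.
elim: j m1 => [|j IH] m1 lj fr ej ivj q.
  exists (tick m1 1); first exact: ev_while0.
  by apply: q => //=; rewrite mul0n addn0.
have [|m2 e2 [t2 iv2]] := body j (tick m1 1) lj fr ej; first by [].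
have f2 := ev_frame e2.
have er : sc m2 r = j.+1 by case: f2 => -> //; rewrite ej.
have eo : sc m2 1 = 1.
  case: f2 => -> //; case: fr => -> //=.
  by rewrite mem_cat inE negb_or w1.
set m3 := setr m2 r (sc m2 r - sc m2 1) 1.
have ebody : ev X (Seq c (Diff r r 1)) (tick m1 1) m3.
  by apply: ev_seq e2 _; apply: ev_sub.
have f3 : frame (For r c) m (tick m3 2).
  apply: frame_trans fr _.
  by apply: frame_sub (ev_frame ebody); split.
have [|||m4 e4 q4] := IH (tick m3 2) (ltnW lj) f3.
- by rewrite /= er eo /upd eqxx subn1.
- by rewrite /= er eo subn1.
- move=> m4 f4 z4 iv4 t4; apply: q => //.
  (* The 4 added to [b] in each round: the test, the decrement and the two instructions that jump
     back. *)
  apply: leq_trans t4 _; move: t2 => /=; lia.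
exists m4 => //; apply: ev_while1 ebody e4.
by rewrite ej.
Qed.

End Wp.

(** * The program *)

Definition bit x t := odd (x %/ 2 ^ t).

Lemma modn_bit x t : x %% 2 ^ t.+1 = x %% 2 ^ t + bit x t * 2 ^ t.
Proof.
have e : x = (x %/ 2 ^ t)./2 * 2 ^ t.+1 + (x %% 2 ^ t + bit x t * 2 ^ t).
  rewrite {1}(divn_eq x (2 ^ t)) -{1}[x %/ 2 ^ t]odd_double_half -/(bit x t).
  by rewrite mulnDl -muln2 -mulnA -expnS; lia.
rewrite {1}e modnMDl modn_small //.
have := ltn_pmod x (expn_gt0 2 t); rewrite expnS.
by case: bit => /=; lia.
Qed.

Notation vone := 1 (only parsing).
Notation vzero := 2 (only parsing).
Notation vp := 3 (only parsing).
Notation vk := 4 (only parsing).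
Notation vN := 5 (only parsing).
Notation vM := 6 (only parsing).
Notation vX := 7 (only parsing).
Notation vlen := 8 (only parsing).
Notation vl := 9 (only parsing).
Notation vid := 10 (only parsing).
Notation vx := 11 (only parsing).
Notation vy := 12 (only parsing).
Notation vt := 13 (only parsing).
Notation vq := 14 (only parsing).
Notation vd := 15 (only parsing).
Notation vf := 16 (only parsing).
Notation vblk := 17 (only parsing).
Notation vi := 18 (only parsing).
Notation vj := 19 (only parsing).
Notation ve := 20 (only parsing).
Notation vb := 21 (only parsing).
Notation vc := 22 (only parsing).
(* aID maps pallet symbols to 1, .., m, with 0 for symbols not met so far; aP
   holds 2^(t-1) for t in 1, .., m; aD the renamed sequences, each ended by 0;
   aT the marks of the numbers x < 2^m; aB[t] is 0 if t is not in the current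
   set, 1 if it is, and 2 if in addition it has been found to be stuck. *)
Notation aID := 0 (only parsing).
Notation aP := 1 (only parsing).
Notation aD := 2 (only parsing).
Notation aB := 3 (only parsing).
Notation aT := 4 (only parsing).

Ltac wp_step := first
  [ apply: wp_seq | apply: wp_assign | apply: wp_sub | apply: wp_get
  | apply: wp_put | apply: wp_inp | apply: wp_skip ].
Ltac wp_simpl := rewrite /setr /seta /tick /upd /=.

Section Spec.
Variable X : nat.

(** Digits are split off from the top, the rest being kept in [vy]. Subtraction is truncated, so y +
    1 - q is nonzero exactly if q <= y. *)
Definition decode_body :=
  Seq (Get vq aP vt) (Seq (Put aB vt vzero) (Seq (Sum vd vy vone)
  (Seq (Diff vd vd vq) (Cond vd (Seq (Put aB vt vone) (Diff vy vy vq)) Skip)))).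
Definition decode :=
  Seq (Diff vy vx vzero) (Seq (Diff vt vM vzero) (For vt decode_body)).

Record consts (m : nat) (mm : memory) : Prop := Consts {
  c_one : sc mm vone = 1;
  c_zero : sc mm vzero = 0;
  c_M : sc mm vM = m;
  c_P : forall u, 0 < u <= m -> ar mm aP u = 2 ^ u.-1;
  c_X : 2 ^ m.+1 <= X }.

Lemma consts_frame c m mm mm' :
  [&& vone \notin wr c, vzero \notin wr c, vM \notin wr c & aP \notin wa c] ->
  frame c mm mm' -> consts m mm -> consts m mm'.
Proof.
case/and4P=> n1 n2 n6 nA [f1 f2 _] [h1 h2 h3 h4 h5].
by split; rewrite ?f1 ?f2 // => u hu; rewrite f2 ?h4.
Qed.

Lemma decode_spec m x mm : consts m mm -> sc mm vx = x -> x < 2 ^ m ->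
  wp X decode (fun mm' => tm mm' <= tm mm + (m * 30 + 3) /\
    forall u, 0 < u <= m -> ar mm' aB u = bit x u.-1) mm.
Proof.
move=> C ex xm; have [one zero eM eP eX] := C.
do 4!wp_step; wp_simpl.
set mm0 := Memory _ _ _ _; have C0 : consts m mm0 by split.
apply: (@wp_for _ _ _ 26 m _ _ (fun j s a _ => s vy = x %% 2 ^ j /\
   forall u, j < u <= m -> a aB u = bit x u.-1)) => //=.
- by rewrite eM zero subn0.
- rewrite ex zero subn0 modn_small //; split=> // u; lia.
- move=> j [s a i t] jm fr /= et [ey eB].
  have [/= one' zero' eM' eP' _] : consts m (Memory s a i t).
    exact: consts_frame fr C0.
  have lt : 0 < j.+1 <= m by [].
  have yl : s 12 < 2 ^ m.
    by rewrite ey; apply: leq_trans (ltn_pmod _ _) _; rewrite ?expn_gt0 ?leq_exp2l.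
  do 5!wp_step; wp_simpl.
  apply: wp_add; wp_simpl; first by rewrite one'; move: eX; rewrite expnS; lia.
  do 2!wp_step; wp_simpl; rewrite et eP' //= one' zero' ey modn_bit addn1.
  have ltj := ltn_pmod x (expn_gt0 2 j).
  apply: wp_cond; wp_simpl.
  + move=> nz; have b1 : bit x j by move: nz; case: bit => //=; lia.
    do 3!wp_step; wp_simpl; rewrite et ey modn_bit b1; split; first by lia.
    split=> [|u /andP[ju um]]; first by rewrite mul1n; lia.
    case: (u =P j.+1) => [->|ne] /=; first by rewrite one' b1.
    by apply: eB; lia.
  + move=> z; have b0 : bit x j = false.
      by move: z; case: bit => //=; rewrite mul1n; lia.
    wp_step; wp_simpl; rewrite ?et ey modn_bit b0; split; first by lia.
    split=> [|u /andP[ju um]]; first by rewrite mul0n addn0.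
    case: (u =P j.+1) => [->|ne] /=; first by rewrite b0.
    by apply: eB; lia.
- move=> mm' fr z [_ eB] t'; split; last exact: eB.
  by apply: leq_trans t' _; rewrite /mm0 /=; lia.
Qed.

End Spec.

(* The entries of [D] that are not removed; [b] tells whether the current
   sequence is already blocked by an entry outside [S]. *)
Fixpoint late (S : pred nat) b (D : seq nat) : seq nat :=
  if D isn't e :: D' then [::]
  else if e == 0 then late S false D'
  else let b' := b || ~~ S e in
       if b' then e :: late S b' D' else late S b' D'.

Definition num_late (S : pred nat) m D :=
  count (fun t => S t && (t \in late S false D)) (iota 1 m).

(** Splits one element off a count: in the scan a pallet just found to be stuck, later the newly
    opened pallet among the open ones. *)
Lemma count_pull (P P' : pred nat) s e : uniq s -> e \in s -> P e ->
  {in s, forall t, P' t = (t != e) && P t} -> count P s = (count P' s).+1.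
Proof.
move=> us es Pe h.
rewrite (permP (perm_to_rem es) P) (permP (perm_to_rem es) P') /= Pe.
rewrite (h e es) eqxx add1n; congr _.+1.
apply: eq_in_count => t; rewrite mem_rem_uniq // => /andP[te ts].
by rewrite h // te.
Qed.

(** * Counting the stuck pallets and marking the successors *)

Section Spec.
Variable X : nat.

(** Mark 2 keeps a pallet with several late bins from being counted again; it is formed as 1 + 1
    since the constants of the language are below 2. *)
Definition scan_body :=
  Seq (Get ve aD vi) (Seq
    (Cond ve
      (Seq (Get vb aB ve)
        (Cond vb
          (Seq (Diff vd vb vone)
            (Cond vd Skip
              (Cond vblk (Seq (Sum vf vf vone) (Seq (Sum vq vone vone)
                            (Put aB ve vq))) Skip)))
          (Diff vblk vone vzero)))
      (Diff vblk vzero vzero))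
    (Sum vi vi vone)).
Definition scan :=
  Seq (Diff vi vzero vzero) (Seq (Diff vblk vzero vzero)
  (Seq (Diff vf vzero vzero) (Seq (Diff vj vN vzero) (For vj scan_body)))).

Record data (Dl : seq nat) m (mm : memory) : Prop := Data {
  d_N : sc mm vN = size Dl;
  d_D : forall i, i < size Dl -> ar mm aD i = nth 0 Dl i;
  d_m : all (fun e => e <= m) Dl;
  d_X : size Dl <= X }.

Lemma data_frame c Dl m mm mm' :
  (vN \notin wr c) && (aD \notin wa c) ->
  frame c mm mm' -> data Dl m mm -> data Dl m mm'.
Proof.
case/andP=> n1 nA [f1 f2 _] [h1 h2 h3 h4].
by split; rewrite ?f1 ?f2 // => u hu; rewrite f2 ?h2.
Qed.

Lemma scan_spec (S : pred nat) Dl m mm : consts X m mm -> data Dl m mm ->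
  (forall u, 0 < u <= m -> ar mm aB u = S u) ->
  wp X scan (fun mm' => tm mm' <= tm mm + (size Dl * 50 + 5) /\
    sc mm' vf = num_late S m Dl /\
    forall u, 0 < u <= m -> (ar mm' aB u != 0) = S u) mm.
Proof.
move=> C Dt eS; have [one zero eM eP eX] := C; have [eN eD eDm NX] := Dt.
do 8!wp_step; wp_simpl.
set mm0 := Memory _ _ _ _.
have C0 : consts X m mm0 by split.
have D0 : data Dl m mm0 by split.
have mX : m < X.
  by have := @ltn_expl 2 m isT; move: eX; rewrite expnS; lia.
(* Mark 1 means in the set and not yet counted. So the pallets counted so far and those of mark 1
   that are late in the unread part make up the total. *)
apply: (@wp_for _ _ _ 46 (size Dl) _ _ (fun j s a _ =>
  [/\ s vi = size Dl - j,
      forall u, 0 < u <= m -> (a aB u != 0) = S u &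
      s vf + count (fun t => (a aB t == 1) &&
          (t \in late S (s vblk != 0) (drop (size Dl - j) Dl))) (iota 1 m) =
      num_late S m Dl])) => //=.
- by rewrite eN zero subn0.
- rewrite zero subn0 subnn drop0 add0n; split=> // [u um|].
    by rewrite eS //; case: (S u).
  by apply: eq_in_count => t; rewrite mem_iota => /andP[t1 t2]; rewrite eS; [case: (S t) | lia].
- move=> j [s a i t] jN fr /= et [ei eB ef].
  have [/= one' zero' eM' eP' _] : consts X m (Memory s a i t).
    exact: consts_frame fr C0.
  have [/= eN' eD' _ _] : data Dl m (Memory s a i t).
    exact: data_frame fr D0.
  have iN : size Dl - j.+1 < size Dl by lia.
  have ed : drop (size Dl - j.+1) Dl =
      nth 0 Dl (size Dl - j.+1) :: drop (size Dl - j) Dl.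
    by rewrite (drop_nth 0 iN); congr (_ :: drop _ _); lia.
  have em := allP eDm _ (mem_nth 0 iN).
  have X2 : 2 <= X by apply: leq_trans eX; rewrite expnS; have := expn_gt0 2 m; lia.
  rewrite ed in ef; set e := nth _ _ _ in ef em ed.
  do 3!wp_step; wp_simpl; rewrite ei eD' // -/e.
  have fin mm2 : tm mm2 <= t + 45 -> sc mm2 vi = size Dl - j.+1 -> sc mm2 vone = 1 ->
     (forall u, 0 < u <= m -> (ar mm2 aB u != 0) = S u) ->
     sc mm2 vf + count (fun t => (ar mm2 aB t == 1) &&
          (t \in late S (sc mm2 vblk != 0) (drop (size Dl - j) Dl))) (iota 1 m) =
      num_late S m Dl ->
     wp X (Sum vi vi vone) (fun m2 => tm m2 <= t + 46 /\
       [/\ sc m2 vi = size Dl - j,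
      forall u, 0 < u <= m -> (ar m2 aB u != 0) = S u &
      sc m2 vf + count (fun t => (ar m2 aB t == 1) &&
          (t \in late S (sc m2 vblk != 0) (drop (size Dl - j) Dl))) (iota 1 m) =
      num_late S m Dl]) mm2.
    move=> h1 h2 h3 h4 h5; apply: wp_add; rewrite h2 h3; first by lia.
    by wp_simpl; split; [lia | split=> //; lia].
  apply: wp_cond; wp_simpl; last first.
    move=> e0; wp_step; wp_simpl; rewrite zero'; apply: fin => //=; first by lia.
    by rewrite -ef /= e0.
  move=> e0; have em' : 0 < e <= m by rewrite lt0n e0.
  rewrite /= (negbTE e0) -/e in ef.
  do 2!wp_step; wp_simpl.
  have eBe := eB e em'.
  apply: wp_cond; wp_simpl; last first.
    move=> b0; wp_step; wp_simpl; rewrite one' zero'; apply: fin => //=; first by lia.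
    rewrite -ef -eBe b0 eqxx orbT; congr (_ + _); apply: eq_in_count => u _.
    by rewrite inE; case: (u =P e) => // ->; rewrite b0.
  move=> b0; do 2!wp_step; wp_simpl.
  rewrite -eBe b0 orbF in ef.
  apply: wp_cond; wp_simpl.
    move=> d0; wp_step; wp_simpl; apply: fin => //=; first by lia.
    rewrite -ef; congr (_ + _); apply: eq_in_count => u _.
    case: (s 17 != 0) => //; rewrite inE; case: (u =P e) => // ->.
    by case: (a 3 e =P 1) => // h; move: d0; rewrite h one'.
  move=> d0; have b1 : a 3 e = 1 by move: d0 b0; rewrite one'; lia.
  apply: wp_cond; wp_simpl.
    move=> blk; rewrite blk in ef.
    have Fm : num_late S m Dl <= m.
      by apply: leq_trans (count_size _ _) _; rewrite size_iota.
    (* The mark of [e] becomes 2: [e] leaves the second summand and is counted in [vf] instead. *)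
    rewrite (@count_pull _ (fun u => ((if u == e then 2 else a 3 u) == 1) &&
      (u \in late S true (drop (size Dl - j) Dl))) _ e) in ef; first last.
    - by move=> u _; rewrite inE; case: (u =P e).
    - by rewrite b1 inE !eqxx.
    - by rewrite mem_iota; lia.
    - exact: iota_uniq.
    wp_step; apply: wp_add; wp_simpl; first by rewrite one'; lia.
    wp_step; apply: wp_add; wp_simpl; first by rewrite one'; lia.
    wp_step; wp_simpl; apply: fin => //=; first by lia.
      by move=> u um; case: (u =P e) => [->|_]; rewrite ?one' ?eB // -eBe b1.
    rewrite -ef one' blk addn1 addSnnS; congr (_ + _.+1).
  move=> blk; wp_step; wp_simpl; apply: fin => //=; first by lia.
  by rewrite blk in ef *.
- move=> mm' fr z [_ eB ef] t'; split; last split=> //.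
    by apply: leq_trans t' _; rewrite /mm0 /=; lia.
  rewrite -ef subn0 drop_size /= -[LHS]addn0; congr (_ + _).
  by rewrite (eq_count (a2 := pred0)) ?count_pred0 // => u; rewrite andbF.
Qed.

Definition relax_body :=
  Seq (Get vb aB vt) (Cond vb Skip
    (Seq (Get vq aP vt) (Seq (Sum vy vx vq) (Put aT vy vone)))).
Definition relax := Seq (Diff vt vM vzero) (For vt relax_body).

(** Membership is tested as a nonzero mark, because the scan has turned some marks 1 into 2. *)
Lemma relax_spec (S : pred nat) x m mm : consts X m mm -> sc mm vx = x ->
  x < 2 ^ m -> (forall u, 0 < u <= m -> (ar mm aB u != 0) = S u) ->
  wp X relax (fun mm' => tm mm' <= tm mm + (m * 30 + 3) /\
    forall y, ar mm' aT y != 0 <->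
      ar mm aT y != 0 \/
      exists u, [/\ 0 < u <= m, ~~ S u & y = x + 2 ^ u.-1]) mm.
Proof.
move=> C ex xm eB; have [one zero eM eP eX] := C.
do 2!wp_step; wp_simpl.
set mm0 := Memory _ _ _ _.
have C0 : consts X m mm0 by split.
apply: (@wp_for _ _ _ 26 m _ _ (fun j s a _ => forall y, a aT y != 0 <->
      ar mm aT y != 0 \/
      exists u, [/\ j < u <= m, ~~ S u & y = x + 2 ^ u.-1])) => //=.
- by rewrite eM zero subn0.
- by move=> y; split=> [|[//|[u [h]]]]; [left | lia].
- move=> j [s a i t] jm fr /= et eT.
  have [/= one' zero' eM' eP' _] : consts X m (Memory s a i t).
    exact: consts_frame fr C0.
  have ex' : s 11 = x by case: fr => /(_ 11 isT) /= ->.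
  have eB' : a 3 j.+1 != 0 = S j.+1.
    by case: fr => _ /(_ 3 isT) /= -> _; apply: eB; lia.
  do 2!wp_step; wp_simpl; rewrite et.
  apply: wp_cond; wp_simpl.
    move=> nz; wp_step; wp_simpl; split; first by lia.
    move=> y; rewrite (eT y); split=> -[h|[u [h1 h2 h3]]]; try by left.
      by right; exists u; split=> //; lia.
    right; exists u; split=> //.
    suff : u != j.+1 by lia.
    by apply: contra h2 => /eqP->; rewrite -eB'.
  move=> z; do 2!wp_step; wp_simpl; rewrite et eP' //=.
  wp_step; apply: wp_add; wp_simpl.
    rewrite ?ex'; apply: leq_trans eX; rewrite expnS.
    by have : 2 ^ j <= 2 ^ m; [rewrite leq_exp2l //; lia | lia].
  wp_step; wp_simpl; rewrite ?ex' one'; split; first by lia.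
  move=> y; case: (y =P x + 2 ^ j) => [->|ne].
    split=> // _; right; exists j.+1; split=> //; first by lia.
    by rewrite -eB' z.
  rewrite (eT y); split=> -[h|[u [h1 h2 h3]]]; try by left.
    by right; exists u; split=> //; lia.
  right; exists u; split=> //.
  by case: (u =P j.+1) h3 => [-> //|]; lia.
- move=> mm' fr z eT t'; split; last exact: eT.
  by apply: leq_trans t' _; rewrite /mm0 /=; lia.
Qed.

End Spec.

(** * Reachable numbers and the main loop *)

Inductive reach (good : pred nat) m : nat -> Prop :=
| reach0 : reach good m 0
| reachS x u : reach good m x -> good x -> 0 < u <= m -> ~~ bit x u.-1 ->
    reach good m (x + 2 ^ u.-1).

(** The content of the table [aT] once all numbers below [x] have been treated. *)
Definition reached_below (good : pred nat) m x y : Prop :=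
  y = 0 \/ exists x' u, [/\ x' < x, reach good m x', good x', 0 < u <= m &
                            ~~ bit x' u.-1 /\ y = x' + 2 ^ u.-1].

(** Adding a power of 2 increases a number, so all predecessors of [y] are below [y] and its mark is
    final when the loop arrives there; one increasing pass suffices. *)
Lemma reached_belowP good m x y : y <= x ->
  reached_below good m x y <-> reach good m y.
Proof.
move=> yx; split=> [[->|[x' [u [_ h1 h2 h3 [h4 ->]]]]]|]; try by constructor.
move=> r; case: r yx => [|x' u h1 h2 h3 h4] yx; first by left.
by right; exists x', u; split=> //; have := expn_gt0 2 u.-1; lia.
Qed.

Section Main.
Variable X : nat.

Definition main_body :=
  Seq (Get vd aT vx) (Seq
    (Cond vd
      (Seq decode (Seq scan (Seq (Diff vd vp vf) (Cond vd relax Skip)))) Skip)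
    (Sum vx vx vone)).
(** After the loop [vx] is 2^m, so its predecessor codes the set of all pallets; the answer goes to
    register 0, which decides acceptance. *)
Definition main :=
  Seq (Put aT vzero vone) (Seq (Diff vx vzero vzero) (Seq (Diff vc vX vzero)
  (Seq (For vc main_body) (Seq (Diff vx vx vone) (Get 0 aT vx))))).

Lemma main_spec Dl m p mm : consts X m mm -> data X Dl m mm ->
  sc mm vX = 2 ^ m -> sc mm vp = p -> (forall y, ar mm aT y = 0) ->
  wp X main (fun mm' =>
    tm mm' <= tm mm + (2 ^ m * (60 * m + 50 * size Dl + 50) + 30) /\
    (sc mm' 0 != 0 <->
     reach (fun x => num_late (fun u => bit x u.-1) m Dl < p) m (2 ^ m).-1)) mm.
Proof.
set good : pred nat := fun x => _.
move=> C Dt eXX ep eT; have [one zero eM eP eX] := C; have [eN eD eDm NX] := Dt.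
have XX : 2 ^ m + 2 ^ m <= X by rewrite addnn -mul2n -expnS.
do 7!wp_step; wp_simpl.
set mm0 := Memory _ _ _ _.
have C0 : consts X m mm0 by split.
have D0 : data X Dl m mm0 by split.
apply: (@wp_for _ _ _ (60 * m + 50 * size Dl + 40) (2 ^ m) _ _ (fun j s a _ =>
  s vx = 2 ^ m - j /\
  forall y, a aT y != 0 <-> reached_below good m (2 ^ m - j) y)) => //=.
- by rewrite eXX zero subn0.
- rewrite zero subn0 subnn; split=> // y; case: (y =P 0) => [->|y0].
    by rewrite one; split=> // _; left.
  by rewrite eT; split=> // -[|[x' [u []]]].
- move=> j [s a i t] jm fr /= et [ex eTT].
  have [/= one' zero' eM' eP' _] : consts X m (Memory s a i t).
    exact: consts_frame fr C0.
  have [/= eN' eD' _ _] : data X Dl m (Memory s a i t).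
    exact: data_frame fr D0.
  have ep' : s 3 = p by case: fr => /(_ 3 isT) /= ->.
  set x := 2 ^ m - j.+1 in ex eTT; have xm : x < 2 ^ m by rewrite /x; lia.
  have exj : 2 ^ m - j = x.+1 by rewrite /x; lia.
  rewrite exj.
  do 3!wp_step; wp_simpl; rewrite ex.
  have fin mm2 : tm mm2 <= t + (60 * m + 50 * size Dl + 38) -> sc mm2 vx = x ->
      sc mm2 vone = 1 ->
      (forall y, ar mm2 aT y != 0 <-> reached_below good m x.+1 y) ->
      wp X (Sum vx vx vone) (fun m2 => tm m2 <= t + (60 * m + 50 * size Dl + 40) /\
        (sc m2 vx = x.+1 /\
        forall y, ar m2 aT y != 0 <-> reached_below good m x.+1 y)) mm2.
    move=> h1 h2 h3 h4; apply: wp_add; rewrite h2 h3; first by lia.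
    by wp_simpl; split; [lia | split=> //; lia].
  (* An unmarked [x], or one with too many stuck pallets, contributes no marks. *)
  have stay : ~ (reach good m x /\ good x) ->
      forall y, reached_below good m x y <-> reached_below good m x.+1 y.
    move=> nr y; split=> -[->|[x' [u [h1 h2 h3 h4 h5]]]]; try by left.
      by right; exists x', u; split=> //; lia.
    right; exists x', u; split=> //.
    by case: (x' =P x) => [e|]; [case: nr; rewrite -e | lia].
  have rx : a 4 x != 0 <-> reach good m x.
    by rewrite (eTT x); apply: reached_belowP.
  apply: wp_cond; wp_simpl; last first.
    move=> z; wp_step; apply: fin => //=; first by lia.
    by move=> y; rewrite (eTT y); apply: stay => -[/rx]; rewrite z.
  move=> /rx rx'; wp_step.
  set mm1 := Memory _ _ _ _.
  have C1 : consts X m mm1 by split.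
  have D1 : data X Dl m mm1 by split.
  apply: (wp_conseq (decode_spec C1 (ex : sc mm1 vx = x) xm)) => mm2 f2 [t2 b2].
  have C2 : consts X m mm2 by apply: consts_frame f2 C1.
  have D2 : data X Dl m mm2 by apply: data_frame f2 D1.
  wp_step.
  apply: (wp_conseq (scan_spec C2 D2 (S := fun u => bit x u.-1) b2)) => mm3 f3 [t3 [ef b3]].
  have C3 : consts X m mm3 by apply: consts_frame f3 C2.
  have ex3 : sc mm3 vx = x.
    by case: f3 => -> // _ _; case: f2 => -> // _ _; apply: ex.
  have ep3 : sc mm3 vp = p.
    by case: f3 => -> // _ _; case: f2 => -> // _ _; apply: ep'.
  have eT3 : ar mm3 aT = a aT.
    by case: f3 => _ -> // _; case: f2 => _ -> // _.
  have eg : (sc mm3 vp - sc mm3 vf != 0) = good x.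
    by rewrite ep3 ef /good; lia.
  do 2!wp_step; wp_simpl.
  rewrite /= in t2 t3.
  have e1 : sc mm3 1 = 1 by case: C3.
  apply: wp_cond; wp_simpl; last first.
    move/eqP; rewrite -[_ == 0]negbK eg => ng; wp_step; apply: fin => //=; first by lia.
    by move=> y; rewrite eT3 (eTT y); apply: stay => -[_]; apply/negP.
  rewrite eg => gx.
  set mm4 := Memory _ _ _ _.
  have C4 : consts X m mm4 by case: C3; split.
  apply: (wp_conseq (relax_spec C4 (ex3 : sc mm4 vx = x) xm b3)) => mm5 f5 [t5 b5].
  have e15 : sc mm5 1 = 1 by case: f5 => ->.
  rewrite /= in t5; apply: fin => //=; first by lia.
    by case: f5 => ->.
  move=> y; rewrite (b5 y) /= eT3 (eTT y).
  split=> [[[->|[x' [u [h1 h2 h3 h4 h5]]]]|[u [h1 h2 h3]]]|].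
  + by left.
  + by right; exists x', u; split=> //; lia.
  + by right; exists x, u.
  + move=> [->|[x' [u [h1 h2 h3 h4 h5]]]]; first by left; left.
    case: (x' =P x) => [e|ne].
      by right; exists u; rewrite -e; case: h5.
    by left; right; exists x', u; split=> //; lia.
- move=> mm' fr z [ex eTT] t'.
  rewrite subn0 in ex eTT.
  have o' : sc mm' 1 = 1 by case: fr => -> //.
  do 3!wp_step; wp_simpl; rewrite ex o' subn1; split.
    by move: t'; rewrite /mm0 /=; rewrite -!addnA /=; lia.
  by rewrite (eTT _); apply: reached_belowP; apply: leq_pred.
Qed.

End Main.

(** * Parsing the input and renaming the pallets *)

Section Codes.
Variable h : nat -> nat.

(** Codes start at 1, since 0 ends a sequence in [codes]. *)
Definition code (ls q : seq nat) : seq nat := [seq (index (h b) ls).+1 | b <- q].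

Definition codes (ls : seq nat) (qs : seq (seq nat)) : seq nat :=
  flatten [seq rcons (code ls q) 0 | q <- qs].

Lemma size_codes ls qs : size (codes ls qs) = size (flatten qs) + size qs.
Proof.
elim: qs => //= q qs IH.
by rewrite /codes /= !size_cat size_rcons size_map -/(codes ls qs) IH; lia.
Qed.

Lemma code_rcons ls l q : {in q, forall b, h b \in ls} ->
  code (rcons ls l) q = code ls q.
Proof.
by move=> hq; apply/eq_in_map => b /hq hb; rewrite -cats1 index_cat hb.
Qed.

(** New symbols are appended at the end of [ls], so codes written earlier stay correct; this is what
    allows renaming in a single pass. *)
Lemma codes_rcons ls l qs : {in flatten qs, forall b, h b \in ls} ->
  codes (rcons ls l) qs = codes ls qs.
Proof.
move=> hq; congr flatten; apply/eq_in_map => q qin; congr rcons.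
by apply: code_rcons => b bq; apply: hq; apply/flattenP; exists q.
Qed.

Lemma codes_le ls qs : {in flatten qs, forall b, h b \in ls} ->
  all (fun e => e <= size ls) (codes ls qs).
Proof.
move=> hq; apply/allP => e /flatten_mapP[q qin]; rewrite mem_rcons inE.
case/predU1P => [->//|/mapP[b bq ->]]; rewrite index_mem.
by apply: hq; apply/flattenP; exists q.
Qed.

Definition encode_seq (q : seq nat) : seq nat :=
  size q :: flatten [seq [:: b; h b] | b <- q].

(* The sequences [qs] and the bins [q] of the current sequence have been read;
   [ls] lists the pallet symbols in the order of their first occurrences. *)
Definition parsed p ls (qs : seq (seq nat)) (q : seq nat)
    (s : nat -> nat) (a : nat -> nat -> nat) : Prop :=
  [/\ uniq ls /\ ls =i map h (flatten qs ++ q),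
      [/\ s vone = 1, s vzero = 0, s vp = p, s vM = size ls &
          s vX = 2 ^ size ls],
      s vN = size (codes ls qs ++ code ls q) /\
      (forall i, i < size (codes ls qs ++ code ls q) ->
         a aD i = nth 0 (codes ls qs ++ code ls q) i),
      forall l, a aID l = if l \in ls then (index l ls).+1 else 0
    & (forall u, 0 < u <= size ls -> a aP u = 2 ^ u.-1) /\
      forall y, a aT y = 0].

(** The first [Inp] discards the name of the bin, of which only the pallet matters. [vX] doubles
    with every new symbol, so that it is 2^m at the end of the input. *)
Definition bin_step :=
  Seq (Inp vl) (Seq (Inp vl) (Seq (Get vid aID vl) (Seq
  (Cond vid Skip
    (Seq (Sum vM vM vone) (Seq (Put aID vl vM) (Seq (Put aP vM vX)
    (Seq (Sum vX vX vX) (Diff vid vM vzero))))))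
  (Seq (Put aD vN vid) (Sum vN vN vone))))).
Definition seq_step :=
  Seq (Inp vlen) (Seq (For vlen bin_step) (Seq (Put aD vN vzero) (Sum vN vN vone))).
Definition parse :=
  Seq (Assign vone 1) (Seq (Inp vp) (Seq (Inp vk)
  (Seq (Diff vX vone vzero) (For vk seq_step)))).

Lemma parsed_ext p ls qs q s a s' a' : {in [:: 1; 2; 3; 5; 6; 7], s =1 s'} ->
  a = a' -> parsed p ls qs q s a -> parsed p ls qs q s' a'.
Proof.
by move=> es <- [h1 [? ? ? ? ?] [? ?] ? ?]; split; rewrite -?es.
Qed.

Variables (X m : nat) (Q : seq (seq nat)).
Hypothesis size_m : size (undup (map h (flatten Q))) = m.
Hypothesis X_m : 2 ^ m.+1 <= X.
Hypothesis X_N : size (flatten Q) + size Q <= X.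

Lemma bin_step_spec p ls qs q1 b q2 qs2 mm rest : Q = qs ++ (q1 ++ b :: q2) :: qs2 ->
  parsed p ls qs q1 (sc mm) (ar mm) -> ip mm = b :: h b :: rest ->
  wp X bin_step (fun mm' => [/\ tm mm' <= tm mm + 40, ip mm' = rest &
    exists ls', parsed p ls' qs (rcons q1 b) (sc mm') (ar mm')]) mm.
Proof.
case: mm => s a i t /= eQ [[us els] [s1 s2 s3 s6 s7] [s5 aD] aI [aP aT]] ei.
have Nlt : size (codes ls qs ++ code ls q1) < X.
  apply: leq_trans X_N; rewrite size_cat size_codes size_map eQ.
  by rewrite flatten_cat /= !size_cat /=; lia.
set l := h b.
have lin : l \in map h (flatten Q).
  apply: map_f; rewrite eQ flatten_cat /= !mem_cat inE eqxx !orbT //.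
have lsub l' : l' \in ls -> l' \in map h (flatten Q).
  rewrite els => /mapP[c cin ->]; apply: map_f; move: cin.
  by rewrite eQ flatten_cat /= !mem_cat => /orP[] ->; rewrite ?orbT.
have inq1 : {in q1, forall b', h b' \in ls}.
  by move=> c cq; rewrite els map_f // mem_cat cq orbT.
have inqs : {in flatten qs, forall b', h b' \in ls}.
  by move=> c cq; rewrite els map_f // mem_cat cq.
do 6!wp_step; wp_simpl; rewrite ei /= aI.
wp_step; apply: wp_cond; wp_simpl.
  case: ifP => // lls _.
  wp_step; do 2!wp_step; wp_simpl.
  apply: wp_add; wp_simpl; first by rewrite s5 s1; lia.
  split=> //; first by lia.
  exists ls; split=> //.
  - split=> // l'; rewrite els !map_cat map_rcons !mem_cat mem_rcons inE.
    case: (l' =P h b) => // ->; rewrite orbT; move: lls; rewrite els map_cat mem_cat.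
    by rewrite /l => ->.
  - rewrite [code ls (rcons _ _)]map_rcons -/(code ls q1) -rcons_cat size_rcons s1 s5 addn1.
    split=> // i0; rewrite ltnS leq_eqVlt nth_rcons /= => lt.
    case: (i0 =P _) lt => [->|ne] /=; first by rewrite ltnn ?eqxx.
    by move=> lt; rewrite lt aD.
case: ifP => // /negbT lls _.
(* The new symbol and those in [ls] are distinct pallets of [Q], so doubling [vX] gives at most
   2^m. *)
have szm : size ls < m.
  rewrite -size_m; apply: (@uniq_leq_size _ (l :: ls)); first by rewrite /= lls.
  move=> l'; rewrite inE mem_undup => /predU1P[->//|]; exact: lsub.
have pm : 2 ^ (size ls).+1 <= 2 ^ m by rewrite leq_exp2l.
have mlt := @ltn_expl 2 m isT.
have eX := X_m; rewrite expnS in eX; rewrite expnS in pm.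
wp_step; apply: wp_add; wp_simpl; first by rewrite s6 s1; lia.
do 4!wp_step; wp_simpl.
wp_step; apply: wp_add; wp_simpl; first by rewrite s7; lia.
do 3!wp_step; wp_simpl.
apply: wp_add; wp_simpl; first by rewrite s5 s1; lia.
split=> //; first by lia.
exists (rcons ls l); split.
- split; first by rewrite rcons_uniq lls.
  move=> l'; rewrite -!cats1 catA (map_cat h (flatten qs ++ q1)) !mem_cat els /=.
  by rewrite !inE.
- split=> //=; first by rewrite s6 s1 size_rcons addn1.
  by rewrite s7 size_rcons expnS addnn mul2n.
- rewrite codes_rcons // [code _ (rcons _ _)]map_rcons -/(code _ q1) code_rcons //.
  rewrite -rcons_cat size_rcons s1 s2 s5 s6 addn1.
  split=> // i0; rewrite ltnS leq_eqVlt nth_rcons /= => lt.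
  case: (i0 =P _) lt => [->|ne] /=.
    by rewrite ltnn ?eqxx -cats1 index_cat (negbTE lls) /= eqxx addn0 addn1 subn0.
  by move=> lt; rewrite lt aD.
- move=> l'; rewrite mem_rcons inE -cats1 index_cat /=.
  rewrite s1 s6 -/l; case: (l' =P l) => [->|ne] /=.
    by rewrite (negbTE lls) eqxx addn0 addn1.
  by rewrite aI; case: ifP.
- split=> // u; rewrite size_rcons /= => um; rewrite s1 s6 s7.
  case: (u =P (size ls).+1) => [->|ne]; first by rewrite addn1 eqxx.
  rewrite addn1 (introF eqP ne); apply: aP; case/andP: um => -> /=.
  by rewrite leq_eqVlt (introF eqP ne).
Qed.

Lemma parse_spec p mm : (forall r, sc mm r = 0) -> (forall A x, ar mm A x = 0) ->
  ip mm = p :: size Q :: flatten [seq encode_seq q | q <- Q] ->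
  wp X parse (fun mm' =>
    tm mm' <= tm mm + (size Q * (44 * size (flatten Q) + 20) + 10) /\
    exists ls, parsed p ls Q [::] (sc mm') (ar mm')) mm.
Proof.
case: mm => s a i t /= s0 a0 ei.
do 8!wp_step; wp_simpl.
rewrite ei /=.
set mm0 := Memory _ _ _ _.
(* Each bin takes 40 instructions and 4 for its round of the inner loop; the length of one sequence
   is bounded by the number of all bins. *)
apply: (@wp_for _ _ _ (44 * size (flatten Q) + 12) (size Q) _ _ (fun j s a i =>
  exists qs1 qs2, [/\ Q = qs1 ++ qs2, size qs2 = j,
    i = flatten [seq encode_seq q | q <- qs2] &
    exists ls, parsed p ls qs1 [::] s a])) => //=.
- exists [::], Q; split=> //; exists [::]; split=> //=; rewrite ?s0 //.
  by split=> // u; lia.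
- move=> j [s' a' i' t'] jm fr /= et [qs1 [qs2 [eQ es ei' [ls par]]]].
  case: qs2 es eQ ei' => [//|q qs2] /= [es] eQ ei'.
  do 2!wp_step; wp_simpl; rewrite ei' /=.
  have qn : size q <= size (flatten Q).
    by rewrite eQ flatten_cat /= !size_cat; lia.
  wp_step.
  apply: (@wp_for _ _ _ 40 (size q) _ _ (fun j s a i =>
    exists q1 q2, [/\ q = q1 ++ q2, size q2 = j,
    i = flatten [seq [:: b; h b] | b <- q2] ++ flatten [seq encode_seq q | q <- qs2] &
    exists ls, parsed p ls qs1 q1 s a])) => //=.
  + by case: par => _ [].
  + exists [::], q; split=> //; exists ls.
    by apply: parsed_ext par => // r; rewrite !inE => /or4P[|||/or3P[]] /eqP->.
  + move=> k [s2 a2 i2 t2] km fr2 /= et2 [q1 [q2 [eq es2 ei2 [ls2 par2]]]].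
    case: q2 es2 eq ei2 => [//|b q2] /= [es2] eq ei2.
    rewrite /= eq in eQ ei2.
    apply: (wp_conseq (bin_step_spec (mm := Memory s2 a2 i2 t2) eQ par2 ei2)).
    move=> [s3 a3 i3 t3] /= f3 [t3' -> [ls3 par3]]; split=> //.
    exists (rcons q1 b), q2; rewrite eq cat_rcons; split=> //; exists ls3.
    by apply: parsed_ext par3 => // r; rewrite !inE => /or4P[|||/or3P[]] /eqP->.
  + move=> [s2 a2 i2 t2] f2 /= z [q1 [q2 [eq es2 ei2 [ls2 par2]]]] tt.
    case: q2 es2 eq ei2 => [|//] _ eq /= ei2.
    rewrite cats0 in eq; rewrite -{q1}eq in par2.
    have [[us els] [s1 s2' s3 s6 s7] [s5 aD] aI [aP aT]] := par2.
    have Nlt : size (codes ls2 qs1 ++ code ls2 q) < X.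
      apply: leq_trans X_N; rewrite size_cat size_codes size_map eQ.
      by rewrite flatten_cat /= !size_cat /=; lia.
    do 2!wp_step; wp_simpl.
    apply: wp_add; wp_simpl; first by rewrite s5 s1; lia.
    split; first by lia.
    exists (rcons qs1 q), qs2; rewrite cat_rcons; split=> //.
    have ecodes : codes ls2 (rcons qs1 q) = rcons (codes ls2 qs1 ++ code ls2 q) 0.
      by rewrite /codes map_rcons flatten_rcons -rcons_cat.
    exists ls2; split=> //=.
    - by split=> // l; rewrite flatten_rcons cats0.
    - rewrite cats0 ecodes size_rcons s1 s5 s2' addn1; split=> // i0.
      rewrite ltnS leq_eqVlt nth_rcons /= => lt.
      case: (i0 =P _) lt => [->|ne] /=; first by rewrite ltnn ?eqxx.
      by move=> lt; rewrite lt aD.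
- move=> [s1 a1 i1 t1] f1 /= z [qs1 [qs2 [eQ es _ par]]] tt; split; first by lia.
  case: qs2 es eQ => [|//] _ eQ.
  by rewrite cats0 in eQ; rewrite eQ.
Qed.

End Codes.

(** * Orders of the pallets *)

Lemma take_find_predC (T : Type) (a : pred T) q :
  all a (take (find (predC a) q) q).
Proof. by elim: q => //= x q IH; case: ifP => //= /negbFE ->. Qed.

Lemma mem_drop_leq (T : eqType) i j (q : seq T) x :
  i <= j -> x \in drop j q -> x \in drop i q.
Proof. by move=> ij; rewrite -(subnK ij) -drop_drop; apply: mem_drop. Qed.

Lemma mem_take_leq (T : eqType) i j (q : seq T) x :
  i <= j -> x \in take i q -> x \in take j q.
Proof. by move=> ij; rewrite -(take_takel q ij); apply: mem_take. Qed.

Section Orders.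
Variable I : instance.
Implicit Types (c d : config I) (S : pred nat) (t u : nat).

Definition cut S (q : seq nat) : nat := find (predC (fun b => S (plt I b))) q.

(* The pallets of [S] that still have bins when every bin for a pallet of [S]
   that is not behind a bin for another pallet has been removed. *)
Definition stuck S u : bool :=
  S u && has (fun q => u \in map (plt I) (drop (cut S q) q)) (seqs I).

Definition num_stuck S : nat := count (stuck S) (pallets I).

Definition good_order (s : seq nat) : Prop :=
  uniq s /\ forall i, i < size s -> num_stuck (mem (take i s)) < places I.

Lemma cut_mono S S' q : (forall u, S u -> S' u) -> cut S q <= cut S' q.
Proof. by move=> h; apply: sub_find => b /=; apply/contra/h. Qed.

Lemma eq_cut S S' q : S =1 S' -> cut S q = cut S' q.
Proof. by move=> h; apply: eq_find => b /=; rewrite h. Qed.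

Lemma cut_size S q : cut S q <= size q.
Proof. exact: find_size. Qed.

Lemma openP c u : reflect
  ((exists j, u \in map (plt I) (removed c j)) /\
   (exists l, u \in map (plt I) (remaining c l))) (is_open c u).
Proof.
apply: (iffP existsP) => [[j /existsP[l /andP[hj hl]]]|[[j hj] [l hl]]].
  by split; [exists j | exists l].
by exists j; apply/existsP; exists l; rewrite hj hl.
Qed.

Lemma has_sequence (P : pred (seq nat)) :
  reflect (exists j : 'I_(size (seqs I)), P (sequence j)) (has P (seqs I)).
Proof.
apply: (iffP (has_nthP [::])) => [[i lt h]|[j h]]; first by exists (Ordinal lt).
by exists j.
Qed.

Lemma sequence_in (j : 'I_(size (seqs I))) : sequence j \in seqs I.
Proof. by rewrite mem_nth. Qed.

Lemma mem_pallets u : u \in pallets I <->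
  exists j : 'I_(size (seqs I)), u \in map (plt I) (sequence j).
Proof.
rewrite mem_undup; split=> [/mapP[b /flattenP[q qin bq] ->]|[j /mapP[b bq ->]]].
  have /has_sequence[j /eqP e] : has (pred1 q) (seqs I) by rewrite has_pred1.
  by exists j; rewrite e map_f.
by apply: map_f; apply/flattenP; exists (sequence j) => //; apply: sequence_in.
Qed.

Definition cut_config S : config I := [ffun j => cut S (sequence j)].

Definition bump_config c j : config I :=
  [ffun l => if l == j then (c l).+1 else c l].

Lemma transformationP c c' : reflect
  (exists2 j, c j < size (sequence j) & c' = bump_config c j)
  (transformation c c').
Proof.
apply: (iffP existsP) => [[j /andP[h /eqP e]]|[j h ->]]; first by exists j.
by exists j; rewrite h /=.
Qed.

(** The missing bins can be removed in any order, since every step stays in the box; induction on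
    their number. *)
Lemma path_between c c' : (forall j, c j <= c' j <= size (sequence j)) ->
  exists w, [/\ path (@transformation I) c w, last c w = c' &
    forall d, d \in c :: w -> forall j, c j <= d j <= c' j].
Proof.
have [n] := ubnP (\sum_j (c' j - c j)).
elim: n c => // n IH c lt cc'.
case: (pickP (fun j => c j < c' j)) => [j cj|eq]; last first.
  have e : c = c'.
    apply/ffunP => j; apply/eqP; rewrite eqn_leq; have := cc' j; move: (eq j) => /=.
    by lia.
  exists [::]; split=> // d; rewrite inE => /eqP-> j.
  by rewrite -e !leqnn.
have cs : c j < size (sequence j) by have := cc' j; lia.
have bl l : c l <= bump_config c j l <= c' l.
  by rewrite ffunE; case: eqP => [->|_]; have := cc' l; lia.
have [||w [pw lw mw]] := IH (bump_config c j).
- apply: leq_trans (ltnSE lt).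
  rewrite [X in X < _](bigD1 j) //= [X in _ < X](bigD1 j) //= ffunE eqxx.
  rewrite -addSn; apply: leq_add; first by lia.
  by apply: leq_sum => l /negbTE lj; rewrite ffunE lj.
- by move=> l; have := bl l; have := cc' l; lia.
exists (bump_config c j :: w); split=> //=.
  by rewrite pw andbT; apply/transformationP; exists j.
move=> d; rewrite inE => /predU1P[-> l|/mw h l]; have := bl l; have := cc' l.
  by lia.
by have := h l; lia.
Qed.

(** An open pallet other than [t] has a removed bin, which lies in a prefix for [S] and [t], so the
    pallet is in [S]; its remaining bin lies behind the prefix for [S], so it is stuck. The
    successor accounts for [t]. *)
Lemma num_open_between S t d :
  (forall j, cut_config S j <= d j <= cut_config [predU1 t & S] j) ->
  num_open d <= (num_stuck S).+1.
Proof.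
move=> between.
apply: (@leq_trans (count (predU (pred1 t) (stuck S)) (pallets I))).
  apply: sub_count => u /openP[[j hj] [l hl]] /=.
  case: (u =P t) => //= ut.
  have Su : S u.
    have /mapP[b bin eu] := hj.
    have := allP (take_find_predC (fun b => [predU1 t & S] (plt I b)) (sequence j)) b.
    rewrite /= -eu.
    case: (u =P t) => //= _; apply.
    apply: mem_take_leq bin; have := between j.
    by rewrite !ffunE => /andP[].
  rewrite /stuck Su; apply/has_sequence; exists l.
  have /mapP[b bin ->] := hl; apply: map_f; apply: mem_drop_leq bin.
  by have := between l; rewrite !ffunE => /andP[].
apply: leq_trans (leq_addr (count (predI (pred1 t) (stuck S)) (pallets I)) _) _.
rewrite count_predUI -add1n leq_add2r.
by rewrite count_uniq_mem ?undup_uniq //; case: (_ \in _).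
Qed.

Lemma order_solvable s : good_order s -> s =i pallets I -> solvable I.
Proof.
case=> us gs es.
(* The processing passes through the configurations [cut_config] of the initial segments of [s]; for
   all of [s] this is [final], as no bin lies outside. *)
suff [w [pw lw ow]] : exists w, [/\ path (@transformation I) (initial I) w,
    last (initial I) w = cut_config (mem s) &
    forall d, d \in initial I :: w -> num_open d <= places I].
  exists w; split=> //; split=> //; rewrite lw; apply/ffunP => j; rewrite !ffunE.
  apply/eqP; rewrite eqn_leq cut_size /= leqNgt -has_find.
  apply/hasPn => b bin /=; rewrite negbK -[in_mem _ _]/(_ \in s) es.
  by apply/mem_pallets; exists j; apply: map_f.
rewrite -[s]take_size; move: (leqnn (size s)).
elim: {-2}(size s) => [|i IH] le.
  exists [::]; split=> //.
    apply/ffunP => j; rewrite !ffunE take0 /cut.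
    by case: (sequence j).
  move=> d; rewrite inE => /eqP->; rewrite /num_open.
  rewrite (eq_count (a2 := pred0)) ?count_pred0 // => u.
  by apply/openP => -[[j]]; rewrite /removed ffunE take0.
have [w [pw lw ow]] := IH (ltnW le).
set S : pred nat := mem (take i s) in lw.
set t := nth 0 s i.
have eS : [predU1 t & S] =1 mem (take i.+1 s).
  by move=> u; rewrite (take_nth 0 le) /= [RHS]mem_rcons inE.
have eC : cut_config (mem (take i.+1 s)) = cut_config [predU1 t & S].
  by apply/ffunP => j; rewrite !ffunE; apply: eq_cut => u; rewrite eS.
have [|w' [pw' lw' bw']] := @path_between (cut_config S) (cut_config [predU1 t & S]).
  move=> j; rewrite !ffunE cut_size andbT; apply: cut_mono => u Su /=.
  by apply/orP; right.
exists (w ++ w'); split.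
- by rewrite cat_path pw lw.
- by rewrite last_cat lw lw' eC.
move=> d; rewrite inE mem_cat orbA -in_cons => /orP[/ow//|dw'].
apply: leq_trans (gs i le); apply: num_open_between.
by apply: bw'; rewrite inE dw' orbT.
Qed.

(** Strict because [t], which is not in [s], is open right after the removal of its first bin, in
    addition to the stuck pallets. *)
Lemma num_stuck_step c j (s : seq nat) : valid I ->
  (forall l, c l <= size (sequence l)) -> c j < size (sequence j) ->
  (forall u, u \in s <-> exists l, u \in map (plt I) (removed c l)) ->
  plt I (nth 0 (sequence j) (c j)) \notin s ->
  num_stuck (mem s) < num_open (bump_config c j).
Proof.
move=> [_ _ _ twice] cS cj sP; set b := nth 0 _ _; set t := plt I b => ts.
have bq : b \in sequence j by rewrite mem_nth.
have tp : t \in pallets I by apply/mem_pallets; exists j; rewrite map_f.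
set c' := bump_config c j.
have c'j : c' j = (c j).+1 by rewrite ffunE eqxx.
have c'l l : l != j -> c' l = c l by move=> /negbTE lj; rewrite ffunE lj.
have dropj : drop (c j) (sequence j) = b :: drop (c' j) (sequence j).
  by rewrite c'j -drop_nth.
have takej : take (c' j) (sequence j) = rcons (take (c j) (sequence j)) b.
  by rewrite c'j (take_nth 0).
have removed_no l : count (fun b => plt I b == t) (removed c l) = 0.
  apply/eqP; rewrite eqn0Ngt -has_count; apply/hasPn => a ain.
  apply: contra ts => /eqP<-; apply/sP; exists l; exact: map_f.
have opent : is_open c' t.
  apply/openP; split.
    by exists j; apply: map_f; rewrite /removed takej mem_rcons mem_head.
  (* If no bin for [t] were left, the bin just removed would be its only one. *)
  have := twice t tp; rewrite count_flatten sumnE big_map (big_nth [::]) big_mkord.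
  case: (pickP (fun l => t \in map (plt I) (remaining c' l))) => [l hl|no].
    by exists l.
  have cd l : count (fun b => plt I b == t) (sequence l) = (l == j).
    rewrite -(cat_take_drop (c' l) (sequence l)) count_cat.
    have -> : count (fun b => plt I b == t) (drop (c' l) (sequence l)) = 0.
      apply/eqP; rewrite eqn0Ngt -has_count; apply/hasPn => a ain.
      by apply: contraFN (no l) => /eqP<-; apply: map_f.
    rewrite addn0; case: (l =P j) => [->|/eqP lj].
      by rewrite takej -cats1 count_cat [in X in X + _](removed_no j) /= eqxx.
    by rewrite c'l //; apply: removed_no.
  rewrite (eq_bigr (fun l => nat_of_bool (l == j))) => [|l _]; last exact: cd.
  by rewrite -big_mkcond /= big_pred1_eq.
rewrite /num_open (@count_pull _ (fun u => (u != t) && is_open c' u) _ t) //;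
  last exact: undup_uniq.
rewrite ltnS; apply: sub_count => u /andP[us /has_sequence[l /mapP[a ain eu]]].
have ut : u != t by apply: contra ts => /eqP<-.
(* Only bins for [s] have been removed, so [c] stays within the prefixes for [s], and whatever lies
   behind them remains. *)
have cutl k : c k <= cut (mem s) (sequence k).
  rewrite leqNgt; apply/negP => lt.
  have hs : has (predC (fun b => mem s (plt I b))) (take (c k) (sequence k)).
    by rewrite has_take_leq.
  have /hasP[x xin /negP[]] := hs.
  by apply/sP; exists k; apply: map_f.
rewrite /= ut /=; apply/openP; split.
  have /sP[k hk] := us; exists k.
  have /mapP[x xin ->] := hk; apply: map_f; apply: mem_take_leq xin.
  by rewrite ffunE; case: ifP.
exists l; rewrite eu; apply: map_f.
have al := mem_drop_leq (cutl l) ain.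
case: (l =P j) al => [->|/eqP lj]; last by rewrite /remaining c'l.
rewrite /remaining dropj inE => /predU1P[ab|//].
by case/eqP: ut; rewrite eu ab.
Qed.

(** The order is that of the first removed bins. It is built along the processing and grows only
    when a bin of a new pallet is removed. *)
Lemma solvable_order : valid I -> solvable I ->
  exists2 s, good_order s & s =i pallets I.
Proof.
move=> vI [w [[pw lw] ow]].
suff main c s : path (@transformation I) c w -> last c w = final I ->
    (forall l, c l <= size (sequence l)) ->
    (forall d, d \in c :: w -> num_open d <= places I) -> good_order s ->
    (forall u, u \in s <-> exists l, u \in map (plt I) (removed c l)) ->
    exists2 s', good_order s' & s' =i pallets I.
  apply: (main (initial I) [::]) => // [l|u]; first by rewrite ffunE.
  by split=> // -[l]; rewrite /removed ffunE take0.
elim: w c s {pw lw ow} => [|c' w IH] c s /=.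
  move=> _ -> _ _ gs sP; exists s => // u.
  apply/idP/idP => [/sP[j]|/mem_pallets[j hj]].
    by rewrite /removed ffunE take_size => hj; apply/mem_pallets; exists j.
  by apply/sP; exists j; rewrite /removed ffunE take_size.
case/andP=> /transformationP[j cj ec'] pw lw cS ow gs sP.
set t := plt I (nth 0 (sequence j) (c j)).
have ow' d : d \in c' :: w -> num_open d <= places I.
  by move=> dw; apply: ow; rewrite inE dw orbT.
have cS' l : c' l <= size (sequence l).
  by rewrite ec' ffunE; case: eqP => [->|].
have c'P u : (exists l, u \in map (plt I) (removed c' l)) <-> u = t \/ u \in s.
  have ej : removed c' j = rcons (removed c j) (nth 0 (sequence j) (c j)).
    by rewrite /removed ec' ffunE eqxx (take_nth 0).
  have el l : l != j -> removed c' l = removed c l.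
    by move=> /negbTE lj; rewrite /removed ec' ffunE lj.
  split=> [[l]|[->|/sP[l hl]]].
  - case: (l =P j) => [->|/eqP lj].
      rewrite ej map_rcons mem_rcons inE => /predU1P[->|h]; first by left.
      by right; apply/sP; exists j.
    by rewrite el // => h; right; apply/sP; exists l.
  - by exists j; rewrite ej map_rcons mem_rcons mem_head.
  - exists l; case: (l =P j) hl => [->|/eqP lj]; last by rewrite el.
    by rewrite ej map_rcons mem_rcons inE orbC => ->.
case: (boolP (t \in s)) => ts.
  apply: (IH c' s) => // u; rewrite c'P.
  by split=> [|[->|]]; [right | |].
apply: (IH c' (rcons s t)) => //; last first.
  move=> u; rewrite c'P mem_rcons inE.
  by split=> [/predU1P|h]; last apply/predU1P.
case: gs => us gs; split; first by rewrite rcons_uniq ts.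
move=> i; rewrite size_rcons ltnS leq_eqVlt => /predU1P[->|lt].
  rewrite -cats1 take_size_cat //.
  apply: leq_trans (num_stuck_step vI cS cj sP ts) _.
  by rewrite -ec'; apply: ow'; rewrite mem_head.
by rewrite -cats1 takel_cat ?gs // ltnW.
Qed.

End Orders.

(** * Binary digits of the codes of sets *)

Lemma bit0n t : bit 0 t = false.
Proof. by rewrite /bit div0n. Qed.

(** Filling an empty digit causes no carry, so nothing changes above it. *)
Lemma divnD_bit x t u : t < u -> ~~ bit x t -> (x + 2 ^ t) %/ 2 ^ u = x %/ 2 ^ u.
Proof.
move=> tu nb; rewrite -(subnKC tu) expnD !divnMA expnSr !divnMA; congr (_ %/ _).
rewrite divnDr // divnn expn_gt0 /= !divn2 halfD /= (negbTE (_ : ~~ odd (x %/ 2 ^ t))) //.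
by rewrite addn0.
Qed.

Lemma bitD x t u : ~~ bit x t -> bit (x + 2 ^ t) u = (u == t) || bit x u.
Proof.
move=> nb; case: (ltngtP u t) => [ut|tu|->] /=.
- rewrite /bit divnDr ?dvdn_exp2l 1?ltnW // oddD -(subnK (ltnW ut)) expnD mulnK ?expn_gt0 //.
  by rewrite oddX /= subn_eq0 leqNgt ut addbF.
- by rewrite /bit divnD_bit.
- by rewrite /bit divnDr // divnn expn_gt0 oddD addbT.
Qed.

Lemma ltn_bitD x t m : t < m -> ~~ bit x t -> x < 2 ^ m -> x + 2 ^ t < 2 ^ m.
Proof.
move=> tm nb lt; have := divnD_bit tm nb; rewrite (divn_small lt) => /eqP.
by rewrite -leqn0 -ltnS ltn_divLR ?expn_gt0 // mul1n.
Qed.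

Lemma all_bits x m : x < 2 ^ m -> (forall t, t < m -> bit x t) -> x = (2 ^ m).-1.
Proof.
move=> lt all; rewrite -[LHS](modn_small lt).
have {lt} : m <= m by [].
elim: {-2}m => [|j IH] jm; first by rewrite expn0 modn1.
rewrite modn_bit all // IH 1?ltnW // mul1n expnS.
by have := expn_gt0 2 j; lia.
Qed.

Lemma reach_lt good m x : reach good m x -> x < 2 ^ m.
Proof.
elim=> [|x' u _ lt _ um nb]; first by rewrite expn_gt0.
by apply: ltn_bitD => //; lia.
Qed.

(** Both values of [b] are covered for the sake of the induction; the terminator 0 lifts the block
    before [D]. *)
Lemma late_cat S b w D : 0 \notin w ->
  late S b (w ++ 0 :: D) = (if b then w else drop (find (predC S) w) w) ++ late S false D.
Proof.
elim: w b => [|e w IH] b /=; first by case: b.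
rewrite inE negb_or eq_sym => /andP[/negbTE-> w0].
by case: b; case: (S e); rewrite /= IH.
Qed.

(** * Reachable numbers and good orders *)

Section Correctness.
Variables (I : instance) (ls : seq nat).
Hypotheses (uls : uniq ls) (els : ls =i map (plt I) (bins I)).
Let m := size ls.
Let D := codes (plt I) ls (seqs I).
Let good x := num_late (fun u => bit x u.-1) m D < places I.

Lemma ls_pallets : perm_eq ls (pallets I).
Proof.
by apply: uniq_perm => // [|u]; rewrite ?undup_uniq // mem_undup els.
Qed.

Lemma mem_code w l : {in w, forall b, plt I b \in ls} -> l \in ls ->
  ((index l ls).+1 \in code (plt I) ls w) = (l \in map (plt I) w).
Proof.
move=> wls lls; apply/mapP/mapP => -[b bw]; last by move=> ->; exists b.
case=> e; exists b => //.
by rewrite -(nth_index 0 lls) e nth_index // wls.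
Qed.

Lemma mem_late S qs l : {in flatten qs, forall b, plt I b \in ls} -> l \in ls ->
  ((index l ls).+1 \in late S false (codes (plt I) ls qs)) =
  has (fun q => l \in map (plt I)
    (drop (cut I (fun u => S (index u ls).+1) q) q)) qs.
Proof.
move=> + lls; elim: qs => //= q qs IH qls.
rewrite /codes /= cat_rcons late_cat; last by apply/mapP => -[].
rewrite mem_cat IH; last by move=> b bq; apply: qls; rewrite mem_cat bq orbT.
congr orb; rewrite /code find_map -map_drop [LHS]mem_code //.
by move=> b /mem_drop bq; apply: qls; rewrite mem_cat bq.
Qed.

Lemma num_late_stuck S S' : {in ls, forall l, S (index l ls).+1 = S' l} ->
  num_late S m D = num_stuck I S'.
Proof.
move=> SS'.
have bls b : b \in bins I -> plt I b \in ls by move=> h; rewrite els map_f.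
rewrite /num_stuck -(permP ls_pallets) /num_late.
(* With the codes 1, .., m written in the order of [ls], both counts run over the same list. *)
have -> : iota 1 m = [seq (index l ls).+1 | l <- ls].
  apply: (@eq_from_nth _ 0) => [|i]; first by rewrite size_iota size_map.
  rewrite size_iota => im.
  by rewrite nth_iota // (nth_map 0) // index_uniq.
rewrite count_map; apply: eq_in_count => l lls /=.
rewrite /stuck SS' // mem_late //; congr andb; apply: eq_in_has => q qin.
congr (_ \in map _ (drop _ _)); apply: eq_in_find => b bq /=.
by rewrite SS' // bls //; apply/flattenP; exists q.
Qed.

Lemma reach_order x : reach good m x ->
  exists s, [/\ good_order I s, {subset s <= ls} &
    {in ls, forall l, bit x (index l ls) = (l \in s)}].
Proof.
elim=> [|{}x u _ [s [[us gs] sls sP]] gx um nb].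
  by exists [::]; split=> // l _; rewrite bit0n.
have ul : u.-1 < size ls by case: (u) um.
set l := nth 0 ls u.-1.
have il : index l ls = u.-1 by rewrite index_uniq.
have lls : l \in ls by rewrite mem_nth.
exists (rcons s l); split.
- split; first by rewrite rcons_uniq us andbT; move: nb; rewrite -il sP.
  move=> i; rewrite size_rcons ltnS leq_eqVlt => /predU1P[->|lt].
    by rewrite -cats1 take_size_cat // -(@num_late_stuck (fun u => bit x u.-1)).
  by rewrite -cats1 takel_cat ?gs // ltnW.
- by move=> l'; rewrite mem_rcons inE => /predU1P[->//|]; apply: sls.
- move=> l' l'ls; rewrite bitD // mem_rcons inE sP //; congr orb.
  apply/eqP/eqP => [e|->]; last exact: il.
  by rewrite -(nth_index 0 l'ls) e.
Qed.

Lemma order_reach s : good_order I s -> {subset s <= ls} ->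
  exists2 x, reach good m x & {in ls, forall l, bit x (index l ls) = (l \in s)}.
Proof.
elim/last_ind: s => [|s l IH] [us gs] sls.
  by exists 0; [constructor | move=> l _; rewrite bit0n].
move: us; rewrite rcons_uniq => /andP[ls' us].
have [||x rx xP] := IH.
- split=> // i lt; have := gs i; rewrite size_rcons -cats1 takel_cat; last exact: ltnW.
  by apply; apply: ltnW.
- by move=> u us'; apply: sls; rewrite mem_rcons inE us' orbT.
have lls : l \in ls by apply: sls; rewrite mem_rcons mem_head.
exists (x + 2 ^ (index l ls)).
  apply: (@reachS _ _ x (index l ls).+1) => //; last by rewrite /= xP.
    rewrite /good (@num_late_stuck _ (mem s)) //.
    have := gs (size s); rewrite size_rcons -cats1 take_size_cat //; apply; exact: ltnSn.
  by rewrite /= index_mem.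
move=> l' l'ls; rewrite bitD ?xP // mem_rcons inE; congr orb.
apply/eqP/eqP => [e|-> //].
by rewrite -(nth_index 0 l'ls) e nth_index.
Qed.

Lemma reach_solvable : valid I -> reach good m (2 ^ m).-1 <-> solvable I.
Proof.
move=> vI; split=> [r|/(solvable_order vI)[s gs es]].
  have [s [gs sls sP]] := reach_order r.
  apply: order_solvable gs _ => l.
  rewrite -(perm_mem ls_pallets); apply/idP/idP => [/sls //|lls].
  rewrite -sP //; set t := index l ls.
  (* An empty digit could be filled without leaving the numbers below 2^m, but the present number is
     the largest of them. *)
  apply/negPn/negP => nb.
  have tm : t < m by rewrite index_mem.
  have := ltn_bitD tm nb (reach_lt r).
  have := expn_gt0 2 t; have := expn_gt0 2 m; lia.
have [|x rx xP] := order_reach gs.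
  by move=> l; rewrite es (perm_mem ls_pallets).
rewrite -(all_bits (reach_lt rx)) // => t tm.
have := xP (nth 0 ls t); rewrite index_uniq // => -> //; rewrite ?mem_nth //.
by rewrite es -(perm_mem ls_pallets) mem_nth.
Qed.

End Correctness.

(** * Running time and conclusion *)

Definition solver : com := Seq parse main.

Lemma bits_size w : size w <= bits w.
Proof. by rewrite /bits; elim: w => //= a w; rewrite /bitlen; lia. Qed.

Lemma mem_bits w a : a \in w -> a <= 2 ^ bits w.
Proof.
move=> aw; have h : bitlen a <= bits w.
  elim: w aw => //= b w IH; rewrite inE /bits /= => /predU1P[->|/IH].
    exact: leq_addr.
  by move=> le; apply: leq_trans le (leq_addl _ _).
apply: leq_trans (_ : 2 ^ bitlen a <= _); last by rewrite leq_exp2l.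
by apply: ltnW; apply: trunc_log_ltn.
Qed.

Lemma size_encode I :
  size (encode I) = 2 + size (seqs I) + 2 * size (bins I).
Proof.
rewrite /encode /bins /=; elim: (seqs I) => //= q qs IH; rewrite !size_cat.
have -> : size (flatten [seq [:: b; plt I b] | b <- q]) = 2 * size q.
  by elim: q {IH} => //= b q ->; lia.
by move: IH; lia.
Qed.

(** The first factor counts the instructions of parsing and search, the second is the charge for one
    of them: a quadratic factor times a linear one gives the cube, and 5000 is 250 * 20, where 52 +
    190 <= 250. *)
Lemma time_bound m k n B : 2 + k + 2 * n <= B -> m <= n ->
  (k * (44 * n + 20) + 10 + (2 ^ m * (60 * m + 50 * (n + k) + 50) + 30)) *
    (20 * B) <= 5000 * 2 ^ m * B ^ 3.
Proof.
move=> le mn.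
have kB : k <= B by lia.
have nB : 2 * n <= B by lia.
have E0 : 0 < 2 ^ m by rewrite expn_gt0.
have a1 : k * (44 * n + 20) + 10 <= 2 ^ m * (52 * B ^ 2).
  apply: leq_trans (leq_pmull _ E0).
  apply: (@leq_trans (B * (22 * B + 20) + 10)); last by nia.
  by rewrite leq_add2r leq_mul //; lia.
have a2 : 2 ^ m * (60 * m + 50 * (n + k) + 50) + 30 <= 2 ^ m * (190 * B ^ 2).
  apply: (@leq_trans (2 ^ m * (60 * m + 50 * (n + k) + 80))); first by nia.
  by rewrite leq_mul2l; apply/orP; right; nia.
have -> : 5000 * 2 ^ m * B ^ 3 = 2 ^ m * (250 * B ^ 2) * (20 * B).
  by rewrite (expnS B 2); nia.
by rewrite leq_mul2r; apply/orP; right; nia.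
Qed.

Theorem theorem8 :
  exists (P : program) (c d : nat),
    forall I : instance, valid I ->
      exists (t : nat) (s : state),
        [/\ runs P (start (encode I)) t s,
            t <= c * 2 ^ num_pallets I * bits (encode I) ^ d
          & accepting s <-> solvable I].
Proof.
exists (compile 0 solver), 5000, 3 => I vI.
(* Each number of the input has at most [B] bits, so [X] bounds all of them, including the pallet
   symbols that serve as addresses. *)
set B := bits (encode I); set X := 2 ^ B.
set n := size (bins I); set k := size (seqs I); set m := num_pallets I.
have sB : 2 + k + 2 * n <= B by rewrite -size_encode; apply: bits_size.
have mn : m <= n.
  by rewrite /m /num_pallets; apply: leq_trans (size_undup _) _; rewrite size_map.
have BX : B < X by apply: ltn_expl.
have X_m : 2 ^ m.+1 <= X by rewrite leq_exp2l //; lia.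
have X_N : size (flatten (seqs I)) + size (seqs I) <= X by rewrite -/(bins I) -/n -/k; lia.
have X0 : 0 < X by rewrite expn_gt0.
set mm0 := Memory (fun=> 0) (fun _ _ => 0) (encode I) 0.
have [mm e [te acc]] : wp X solver (fun mm =>
    tm mm <= k * (44 * n + 20) + 10 + (2 ^ m * (60 * m + 50 * (n + k) + 50) + 30) /\
    (sc mm 0 != 0 <-> solvable I)) mm0.
  apply: wp_seq.
  apply: (wp_conseq (@parse_spec (plt I) X m (seqs I) (erefl _) X_m X_N
    (places I) mm0 _ _ _)) => // mm f [t [ls par]].
  have [[us els] [s1 s2 s3 s6 s7] [s5 aD] aI [aP aT]] := par.
  rewrite !cats0 in els s5 aD.
  have szls : size ls = m.
    by rewrite (perm_size (ls_pallets us els)).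
  rewrite szls in s6 s7 aP.
  have C : consts X m mm by split.
  have Dt : data X (codes (plt I) ls (seqs I)) m mm.
    split=> //; last by rewrite size_codes.
    by rewrite -szls; apply: codes_le => b bin; rewrite els map_f.
  apply: (wp_conseq (main_spec C Dt s7 s3 aT)) => mm' f' [t' acc].
  rewrite size_codes in t'; split.
    by apply: leq_trans t' _; rewrite leq_add2r; apply: t.
  by rewrite acc -szls; apply: reach_solvable.
(* The encoding has at least two numbers, so [B] is at least 2 and five numbers of [B + 6] bits fit
   into [20 * B]. *)
have W5 : 5 * bitlen (8 * X + 40) <= 20 * B.
  have : bitlen (8 * X + 40) <= B + 6.
    rewrite -(ltn_exp2l _ _ (ltnSn 1)); apply: leq_ltn_trans (trunc_logP _ _) _ => //.
      by rewrite addn_gt0 orbT.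
    by rewrite expnD -/X; lia.
  by lia.
have [||t [s [r tb es]]] := compile_runs X0 W5 _ _ e.
- by move=> a; apply: mem_bits.
- by [].
exists t, s; split=> //.
  apply: leq_trans tb _; apply: leq_trans (time_bound sB mn).
  by rewrite leq_mul2r te orbT.
by rewrite /accepting es.
Qed.
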